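(* Let $G$ be a countable group with a minimal non-elementary convergence group action $(\rho,X)$. Then the following are equivalent: (i) the action $(\rho,X)$ is effective; (ii) $G$ is a Powers group; (iii) the reduced $C^*$-algebra of $G$ is simple; (iv) the reduced $C^*$-algebra of $G$ has a unique normalized trace; (v) $G$ has infinite conjugacy classes, i.e. the conjugacy class of every element of $G\setminus\{1\}$ is infinite; (vi) $G$ does not have non-trivial amenable normal subgroups; (vii) $G$ does not have non-trivial finite normal subgroups; (viii) all minimal non-elementary convergence group actions of $G$ are effective.
   Context: Convergence group action: Let $G$ be a countable group, $X$ a compact metrizable space and $\rho:G\to \mathrm{Homeo}(X)$ a homomorphism. The pair $(\rho,X)$ is a convergence group action of $G$ if $X$ has at least three points and, for any infinite sequence $\{g_i\}$ of mutually different elements of $G$, there exist a subsequence $\{g_{i_j}\}$ and two (possibly equal) points $r,a\in X$ such that $\rho(g_{i_j})|_{X\setminus\{r\}}$ converges to (the constant map) $a$ uniformly on compact subsets of $X\setminus\{r\}$ and $\rho(g_{i_j}^{-1})|_{X\setminus\{a\}}$ converges to $r$ uniformly on compact subsets of $X\setminus\{a\}$. Such a sequence $\{g_{i_j}\}$ is called a convergence sequence, with repelling point $r$ and attracting point $a$. The limit set $\Lambda(\rho)\subset X$ is the set of all repelling points and attracting points of convergence sequences of $(\rho,X)$. The action is non-elementary if $\Lambda(\rho)$ is infinite. It is minimal if every $\rho(G)$-orbit is dense in $X$, and effective if $\rho$ is injective. Powers group: A group $G$ is a Powers group if $G\neq\{1\}$ and, for every finite subset $F\subset G\setminus\{1\}$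 and every integer $N\ge 1$, there exist a partition $G=C\sqcup D$ and elements $\gamma_1,\dots,\gamma_N\in G$ such that $fC\cap C=\emptyset$ for all $f\in F$ and $\gamma_jD\cap\gamma_kD=\emptyset$ for all $j\neq k$ in $\{1,\dots,N\}$. The reduced $C^*$-algebra of $G$ is the norm closure of the linear span of the left regular representation of $G$ on $\ell^2(G)$. It is simple if it has no non-trivial closed two-sided ideals. A normalized trace on a unital $C^*$-algebra $A$ is a positive linear functional $\tau$ on $A$ with $\tau(1)=1$ and $\tau(xy)=\tau(yx)$ for all $x,y\in A$. *)

(* Defs.v *)
From HB Require Import structures.
From mathcomp Require Export all_boot all_order all_algebra.
From mathcomp Require Export all_classical all_reals all_analysis.
From mathcomp Require Export complex.
From mathcomp Require Import ring.

Set Implicit Arguments.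
Unset Strict Implicit.
Unset Printing Implicit Defensive.

Import Order.TTheory GRing.Theory Num.Theory.
Import numFieldNormedType.Exports.

Local Open Scope classical_set_scope.
Local Open Scope ring_scope.
Local Open Scope complex_scope.

Section Groups.
Variable G : groupType.
Implicit Types (H C D F : set G).

Definition translate (g : G) C : set G := [set (g * c)%g | c in C].

Definition powers_group : Prop :=
  (exists g : G, g != 1%g) /\
  forall (F : set G) (N : nat), finite_set F -> ~ F 1%g -> (1 <= N)%N ->
  exists (C D : set G) (gamma : 'I_N -> G),
    [/\ C `|` D = [set: G], C `&` D = set0,
        forall f, F f -> translate f C `&` C = set0 &
        forall j k, j != k ->
          translate (gamma j) D `&` translate (gamma k) D = set0].

Definition conj_class (g : G) : set G := [set (g ^ x)%g | x in [set: G]].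

Definition icc : Prop := forall g : G, g != 1%g -> infinite_set (conj_class g).

Record normal_subgroup H : Prop := NormalSubgroup {
  normal_subgroup1 : H 1%g;
  normal_subgroupM : forall x y, H x -> H y -> H (x * y)%g;
  normal_subgroupV : forall x, H x -> H (x^-1)%g;
  normal_subgroupJ : forall x y, H x -> H (x ^ y)%g }.

(* Amenability of a subgroup H as a discrete group: a finitely additive
   left-invariant probability measure m on the subsets of H; the values of m
   on the other subsets of G are irrelevant. *)
Definition amenable (R : realType) H : Prop :=
  exists m : set G -> R,
    [/\ m H = 1,
        forall A, A `<=` H -> 0 <= m A,
        forall A B, A `<=` H -> B `<=` H -> A `&` B = set0 ->
          m (A `|` B) = m A + m B &
        forall h A, H h -> A `<=` H -> m (translate h A) = m A].

End Groups.

Section ConvergenceActions.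
(* A compact metrizable space is presented with a compatible metric; by
   compactness, uniform convergence does not depend on this choice. *)
Variables (R : realType) (G : groupType) (X : metricType R).
Implicit Types (rho : G -> X -> X) (u : nat -> G).

Definition homeomorphism (f : X -> X) : Prop :=
  exists f' : X -> X,
    [/\ cancel f f', cancel f' f, continuous f & continuous f'].

Definition homeo_action rho : Prop :=
  (forall g, homeomorphism (rho g)) /\
  (forall g h, rho (g * h)%g = rho g \o rho h).

Definition convergence_seq rho u (r a : X) : Prop :=
  [/\ injective u,
      {family compactly_in (~` [set r]),
        (rho \o u) @ \oo --> (fun=> a : X)} &
      {family compactly_in (~` [set a]),
        (fun n => rho (u n)^-1%g) @ \oo --> (fun=> r : X)}].

Record convergence_action rho : Prop := ConvergenceAction {
  conv_compact : compact [set: X];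
  conv_homeo : homeo_action rho;
  conv_three_points : exists x y z : X, [/\ x != y, y != z & x != z];
  conv_subseq : forall u, injective u ->
    exists (phi : nat -> nat) (r a : X),
      {homo phi : m n / (m < n)%N} /\ convergence_seq rho (u \o phi) r a }.

Definition limit_set rho : set X :=
  [set x | exists u r a, convergence_seq rho u r a /\ (x = r \/ x = a)].

Definition non_elementary rho : Prop := infinite_set (limit_set rho).

Definition minimal_action rho : Prop :=
  forall x : X, dense [set rho g x | g in [set: G]].

Definition effective rho : Prop := injective rho.

End ConvergenceActions.

Section Ell2.
Variables (R : realType) (G : groupType).
Local Notation C := R[i].
Local Notation normc := ComplexField.Normc.normc.

Definition sqnorm (f : G -> C) : \bar R :=
  \esum_(g in [set: G]) (normc (f g) ^+ 2)%:E.

Definition square_summable : {pred (G -> C)} := fun f => `[< (sqnorm f < +oo)%E >].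

Fact sqnorm_ge0 f : (0 <= sqnorm f)%E.
Proof. by apply: esum_ge0 => g _; rewrite lee_fin sqr_ge0. Qed.

Fact normcD_le (x y : C) :
  normc (x + y) ^+ 2 <= 2 * normc x ^+ 2 + 2 * normc y ^+ 2.
Proof.
case: x y => [a b] [c d] /=; rewrite !sqr_sqrtr ?addr_ge0 ?sqr_ge0 //.
rewrite -subr_ge0.
rewrite (_ : _ - _ = (a - c) ^+ 2 + (b - d) ^+ 2) ?addr_ge0 ?sqr_ge0 //.
by ring.
Qed.

Fact esumZ_le (c : R) (u : G -> R) : 0 <= c -> (forall g, 0 <= u g) ->
  (\esum_(g in [set: G]) (c * u g)%:E <=
   c%:E * \esum_(g in [set: G]) (u g)%:E)%E.
Proof.
move=> c0 u0; apply: ge_ereal_sup => _ [A [finA _] <-].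
have -> : (\sum_(x \in A) (c * u x)%:E = c%:E * \sum_(x \in A) (u x)%:E)%E.
  rewrite ge0_mule_fsumr; last by move=> x; rewrite lee_fin.
  by apply: eq_fsbigr => x _; rewrite EFinM.
by apply: lee_wpmul2l; [rewrite lee_fin | apply: esum_ge; exists A].
Qed.

Fact square_summable_closed : submod_closed square_summable.
Proof.
split; first apply/asboolP.
  rewrite /sqnorm esum1 ?ltry // => g _.
  by rewrite ComplexField.Normc.normc0 expr0n.
move=> c f h /asboolP sf /asboolP sh; apply/asboolP.
pose M := 2 * normc c ^+ 2.
have M0 : 0 <= M by rewrite mulr_ge0 ?sqr_ge0.
apply: (@le_lt_trans _ _ (M%:E * sqnorm f + 2%:E * sqnorm h)%E); last first.
  by rewrite lte_add_pinfty // lte_mul_pinfty // ?lee_fin.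
apply: (@le_trans _ _ (\esum_(g in [set: G])
    ((M * normc (f g) ^+ 2)%:E + (2 * normc (h g) ^+ 2)%:E))%E).
  apply: le_esum => g _; rewrite -EFinD lee_fin.
  apply: le_trans (normcD_le _ _) _.
  by rewrite /= [(c *: f) g]/(c * f g) ComplexField.Normc.normcM exprMn mulrA.
rewrite esumD; last 2 first.
- by move=> g _; rewrite lee_fin mulr_ge0 ?sqr_ge0.
- by move=> g _; rewrite lee_fin mulr_ge0 ?sqr_ge0.
by apply: leeD; apply: esumZ_le => // g; rewrite sqr_ge0.
Qed.

HB.instance Definition _ := GRing.isSubmodClosed.Build C (G -> C)
  square_summable square_summable_closed.

Record ell2 := Ell2 {
  ell2_fun :> G -> C;
  _ : ell2_fun \in square_summable }.

HB.instance Definition _ := [isSub for ell2_fun].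
HB.instance Definition _ := [Choice of ell2 by <:].
HB.instance Definition _ := [SubChoice_isSubLmodule of ell2 by <:].

Implicit Types f h : ell2.

Definition ell2_norm f : R := Num.sqrt (fine (sqnorm f)).

(* The sum over G of an absolutely summable family. *)
Definition rsum (u : G -> R) : R :=
  fine (\esum_(g in [set: G]) (u^\+ g)%:E) -
  fine (\esum_(g in [set: G]) (u^\- g)%:E).

Definition csum (u : G -> C) : C :=
  rsum (fun g => complex.Re (u g)) +i* rsum (fun g => complex.Im (u g)).

Definition ell2_dot f h : C := csum (fun g => f g * (h g)^*).

Fact left_regular_subproof (x : G) f :
  (fun g => f (x^-1 * g)%g) \in square_summable.
Proof.
case: f => f /= /asboolP sf; apply/asboolP; rewrite /sqnorm.
move: sf; congr (_ < _)%E; rewrite /sqnorm.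
rewrite (reindex_esum [set: G] [set: G] (fun g => x^-1 * g)%g) //.
split => //; first by move=> a b _ _; apply: mulgI.
by move=> y _; exists (x * y)%g; rewrite // mulKg.
Qed.

Definition left_regular (x : G) : ell2 -> ell2 :=
  fun f => Ell2 (left_regular_subproof x f).

Implicit Types (S T : ell2 -> ell2) (E I : set (ell2 -> ell2)).

Definition bounded_operator T : Prop :=
  linear T /\ exists M : R, forall f, ell2_norm (T f) <= M * ell2_norm f.

(* The last conjunct says that the operator norm of T - S is at most eps. *)
Definition norm_closure E : set (ell2 -> ell2) :=
  [set T | bounded_operator T /\
    forall eps : R, 0 < eps ->
      exists S, E S /\ forall f, ell2_norm (T f - S f) <= eps * ell2_norm f].

Definition left_regular_span : set (ell2 -> ell2) :=
  [set T | exists s : seq (C * G), T = \sum_(p <- s) p.1 *: left_regular p.2].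

Definition reduced_Cstar : set (ell2 -> ell2) := norm_closure left_regular_span.

Record closed_ideal I : Prop := ClosedIdeal {
  ideal_sub : I `<=` reduced_Cstar;
  ideal0 : I 0;
  ideal_linear : forall (c : C) S T, I S -> I T -> I (c *: S + T);
  ideal_mull : forall S T, reduced_Cstar S -> I T -> I (S \o T);
  ideal_mulr : forall S T, I S -> reduced_Cstar T -> I (S \o T);
  ideal_closed : norm_closure I `<=` I }.

Definition reduced_Cstar_simple : Prop :=
  forall I, closed_ideal I -> I = [set 0] \/ I = reduced_Cstar.

Definition adjoint T S : Prop :=
  forall f h, ell2_dot (T f) h = ell2_dot f (S h).

(* Only the values of tau on the reduced C*-algebra are constrained. *)
Record normalized_trace (tau : (ell2 -> ell2) -> C) : Prop := NormalizedTrace {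
  trace_linear : forall (c : C) S T, reduced_Cstar S -> reduced_Cstar T ->
    tau (c *: S + T) = c * tau S + tau T;
  trace_pos : forall S T, reduced_Cstar T -> reduced_Cstar S -> adjoint T S ->
    0 <= tau (S \o T);
  trace1 : tau idfun = 1;
  traceC : forall S T, reduced_Cstar S -> reduced_Cstar T ->
    tau (S \o T) = tau (T \o S) }.

Definition reduced_Cstar_unique_trace : Prop :=
  exists tau, normalized_trace tau /\
    forall tau', normalized_trace tau' ->
      forall T, reduced_Cstar T -> tau' T = tau T.

End Ell2.

(* Main.v *)
(** The implications (ii) => (iii), (iv), (v), (vi) hold for every Powers group, each of
    (iii), (iv), (v), (vi) forbids nontrivial finite normal subgroups, and the kernel of a
    convergence action is a finite normal subgroup; this closes every cycle through (vii),
    (viii) and (i), except for (i) => (ii).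

    (i) => (ii): a convergence sequence whose repelling point is moved into an open set U
    contracts the complement of U to a point. Translating its attracting point along its
    infinite orbit yields gamma_j that map X \ U to pairwise disjoint sets, so that
    C = {g | g x0 \in U} works as soon as every f in F moves U off itself. Such a U exists
    because the fixed point set of f <> 1 has empty interior.

    (ii) => (iii), (iv): averaging over the conjugates by gamma_1, ..., gamma_N shrinks a
    finitely supported operator with zero trace by a factor 2 / sqrt N. A nonzero ideal
    thus contains elements close to 1, and a bounded trace must be the canonical one;
    positive traces are bounded because 1 - x is a square for self-adjoint x of norm
    at most 1/2.

    Conversely, a finite normal subgroup H gives the ideal of the T with T lambda(h) = T
    for h in H, and the vector trace of the indicator function of H. *)

From HB Require Import structures.
Require Import Defs.
From mathcomp Require Import sesquilinear ring lra.

Set Implicit Arguments.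
Unset Strict Implicit.
Unset Printing Implicit Defensive.

Import Order.TTheory GRing.Theory Num.Theory.
Import numFieldNormedType.Exports ComplexField.Normc.

Local Open Scope complex_scope.
Local Open Scope classical_set_scope.
Local Open Scope ring_scope.

#[local] Arguments ell2_fun : simpl never.
#[local] Arguments ell2_dot : simpl never.

Lemma le0_of_le_eps (R : realFieldType) (x K : R) :
  (forall e, 0 < e -> x <= e * K) -> x <= 0.
Proof.
move=> x_le; have [K0|K0] := leP K 0.
  by apply: le_trans (x_le 1 ltr01) _; rewrite mul1r.
apply/ler_addgt0Pr => e e0; rewrite add0r.
by apply: le_trans (x_le (e / K) _) _; rewrite ?divr_gt0 // divfK // gt_eqF.
Qed.

Lemma sqr_sum_le (R : realFieldType) N (a : 'I_N -> R) :
  (\sum_j a j) ^+ 2 <= N%:R * \sum_j a j ^+ 2.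
Proof.
case: N a => [|N] a; first by rewrite !big_ord0 expr0n mul0r.
pose t := (\sum_j a j) / N.+1%:R.
have N0 : N.+1%:R != 0 :> R by rewrite pnatr_eq0.
suff -> : N.+1%:R * \sum_j a j ^+ 2 =
    (\sum_j a j) ^+ 2 + N.+1%:R * \sum_j (a j - t) ^+ 2.
  by rewrite lerDl mulr_ge0 // sumr_ge0 // => j _; exact: sqr_ge0.
have -> : \sum_j (a j - t) ^+ 2 =
    \sum_j a j ^+ 2 - 2 * t * (\sum_j a j) + N.+1%:R * t ^+ 2.
  rewrite (eq_bigr (fun j => a j ^+ 2 - 2 * t * a j + t ^+ 2)); last first.
    by move=> j _; ring.
  by rewrite big_split /= sumrB -mulr_sumr sumr_const card_ord -[X in _ + X = _]mulr_natl.
by rewrite /t; field; rewrite -natr1 in N0 *.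
Qed.

Lemma normr_half_lt1 (R : realFieldType) : `|2^-1 : R| < 1.
Proof. by rewrite ger0_norm ?invr_ge0 // invf_lt1 // ltr1n. Qed.

Lemma geometric_lt (R : realType) (K e q : R) : `|q| < 1 -> 0 < e ->
  exists n, K * q ^+ n < e.
Proof.
move=> q1 e0.
have /cvgrPdist_lt/(_ _ e0)[n _ /(_ _ (leqnn n)) /=] := cvg_geometric K q1.
by rewrite sub0r normrN => Kqn; exists n; exact: le_lt_trans (ler_norm _) Kqn.
Qed.

Lemma is_cvg_geometric_increments (R : realType) (u : R^nat) (c q : R) :
  `|q| < 1 -> (forall n, `|u n.+1 - u n| <= c * q ^+ n) -> cvgn u.
Proof.
move=> q1 u_le; have -> : u = (fun=> u 0) \+ series (telescope u).
  by apply/funext => n; exact: eq_sum_telescope.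
apply: is_cvgD; first exact: is_cvg_cst.
apply: normed_cvg.
apply: (@series_le_cvg _ (fun n => `|telescope u n|) (geometric c q)) => [n|n|n|].
- exact: normr_ge0.
- exact: le_trans (u_le n).
- exact: u_le.
- exact: is_cvg_geometric_series.
Qed.

Lemma near_notin_finite (T : Type) (u : nat -> T) (F : set T) :
  injective u -> finite_set F -> \forall n \near \oo, ~ F (u n).
Proof.
move=> inj_u finF.
have /finite_seqP[s us] : finite_set (u @^-1` F).
  by apply: finite_preimage finF => m n _ _; exact: inj_u.
exists (\max_(k <- s) k).+1 => // n /= lt_n Fun.
have : (u @^-1` F) n by [].
by rewrite us => ns; move: lt_n; rewrite ltnNge (@leq_bigmax_seq _ s predT id).
Qed.

Lemma infinite_range (T : choiceType) (u : nat -> T) :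
  (forall n, \forall m \near \oo, u m <> u n) -> infinite_set (range u).
Proof.
move=> u_escapes /finite_seqP[s us].
have [m um] : exists m, forall x, x \in s -> u m <> x.
  suff : \forall m \near \oo, forall x, x \in s -> u m <> x by move=> /filter_ex.
  have : {subset s <= range u} by move=> x xs; rewrite us inE.
  elim: s {us} => [|x s IH] s_range; first exact: nearW.
  have [n _ <-] : range u x by apply/set_mem/s_range; rewrite inE eqxx.
  have IHs := IH (fun y ys => s_range y (mem_behead (s := x :: s) ys)).
  apply: filterS2 (u_escapes n) IHs => m umn ums y.
  by rewrite inE => /orP[/eqP ->|/ums].
by apply: (um (u m)) => //; have : range u (u m) by []; rewrite us.
Qed.

Lemma infinite_injective_seq (T : choiceType) (A : set T) : infinite_set A ->
  exists2 u : nat -> T, injective u & forall n, A (u n).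
Proof.
move=> infA; have [x _] := infinite_setN0 infA.
pose pT : pointedType := HB.pack T (isPointed.Build T x).
move: infA => /(@infiniteP pT)/pcard_leP[u].
exists u => [m n umn|n]; last exact: (@funS _ _ _ _ u).
by apply: (@inj _ _ _ u); rewrite ?inE.
Qed.

(** * Complex norms and sums over a group *)

Section ComplexNorm.
Variable R : rcfType.
Implicit Types x y : R[i].

Lemma normc_ge0 x : 0 <= normc x.
Proof. exact: (normr_ge0 (x : Rcomplex R)). Qed.

Lemma normc_real (a : R) : normc a%:C = `|a|.
Proof. by rewrite /= expr0n addr0 sqrtr_sqr. Qed.

Lemma normc_natr n : normc n%:R = n%:R :> R.
Proof. by rewrite -(rmorph_nat (real_complex R)) normc_real normr_nat. Qed.

Lemma normc_i : normc 'i = 1 :> R.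
Proof. by rewrite /= expr0n expr1n add0r sqrtr1. Qed.

Lemma normc_conj x : normc x^* = normc x.
Proof. by case: x => a b; rewrite /= sqrrN. Qed.

Lemma sqr_normcE x : normc x ^+ 2 = complex.Re x ^+ 2 + complex.Im x ^+ 2.
Proof. by case: x => a b; rewrite /= sqr_sqrtr ?addr_ge0 ?sqr_ge0. Qed.

Lemma normc_leD x y : normc (x + y) <= normc x + normc y.
Proof. exact: le_normcD. Qed.

Lemma normc_leB x y : normc (x - y) <= normc x + normc y.
Proof. by rewrite -(normcN (y : Rcomplex R)) normc_leD. Qed.

Lemma normRe_le_normc x : `|complex.Re x| <= normc x.
Proof. by rewrite -lecR; exact: normc_ge_Re. Qed.

Lemma normIm_le_normc x : `|complex.Im x| <= normc x.
Proof.
rewrite -(@ler_pXn2r _ 2) ?nnegrE ?normc_ge0 // sqr_normcE real_normK ?num_real //.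
by rewrite lerDr sqr_ge0.
Qed.

Lemma normc_eq0_eps x (K : R) :
  (forall e, 0 < e -> normc x <= e * K) -> x = 0.
Proof.
move=> /le0_of_le_eps x_le0; apply: eq0_normc.
by apply/eqP; rewrite eq_le x_le0 normc_ge0.
Qed.

End ComplexNorm.

Section RealFamilies.
Variables (R : realType) (T : choiceType).
Implicit Types (u v : T -> R) (c : R) (t : T).
Local Notation esumT u := (\esum_(t in [set: T]) (u t)%:E)%E.
Local Notation summableT u := (summable [set: T] (fun t => (u t)%:E)).

Lemma esumZ c u : 0 <= c -> (forall t, 0 <= u t) ->
  (esumT (fun t => (c * u t)%R) = c%:E * esumT u)%E.
Proof.
move=> c0 u0; rewrite /esum -ereal_supZl //; last first.
  by apply/set0P; exists 0%E; exists set0; [exact: fsets_set0 | rewrite fsbig_set0].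
rewrite image_comp; congr ereal_sup; apply: eq_imagel => A [finA _] /=.
rewrite ge0_mule_fsumr; last by move=> x; rewrite lee_fin.
by apply: eq_fsbigr => x _; rewrite EFinM.
Qed.

Lemma term_le_esum u t : (forall x, 0 <= u x) -> ((u t)%:E <= esumT u)%E.
Proof.
move=> u0; apply: esum_ge; exists [set t]; first by split.
by rewrite fsbig_set1.
Qed.

Lemma esum_supp1 u x : (forall t, 0 <= u t) -> (forall t, t != x -> u t = 0) ->
  esumT u = (u x)%:E.
Proof.
move=> u0 ux; rewrite (esumID [set x]) => [|t _]; last by rewrite lee_fin.
by rewrite setTI esum_set1 ?lee_fin // setTI esum1 ?adde0 // => t /eqP/ux ->.
Qed.

Lemma ge0_esumD u v : (forall t, 0 <= u t) -> (forall t, 0 <= v t) ->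
  (esumT (u \+ v)%R = esumT u + esumT v)%E.
Proof. by move=> u0 v0; rewrite -esumD // => t _; rewrite lee_fin. Qed.

Lemma ge0_summableE u : (forall t, 0 <= u t) -> summableT u = (esumT u < +oo)%E.
Proof.
move=> u0; rewrite /summable; congr (_ < _)%E; apply: eq_esum => t _.
by rewrite gee0_abs ?lee_fin.
Qed.

Lemma le_summable u v : (forall t, `|u t| <= v t) -> (esumT v < +oo)%E -> summableT u.
Proof. by move=> uv; apply: le_lt_trans; apply: le_esum => t _; rewrite lee_fin. Qed.

Lemma summableZ c u : summableT u -> summableT (fun t => c * u t).
Proof.
rewrite /summable; under [in X in _ -> X]eq_esum do rewrite EFinM abseM /= -EFinM.
by rewrite esumZ // => u_oo; rewrite lte_mul_pinfty ?lee_fin.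
Qed.

Lemma esum_fin_num u : (forall t, 0 <= u t) -> (esumT u < +oo)%E ->
  esumT u \is a fin_num.
Proof. by move=> u0; rewrite ge0_fin_numE ?esum_ge0 // => t _; rewrite lee_fin. Qed.

Lemma EFin_funrpos u t : (u^\+ t)%:E = ((EFin \o u)^\+ t)%E.
Proof. by rewrite funeposE -EFin_max. Qed.

Lemma EFin_funrneg u t : (u^\- t)%:E = ((EFin \o u)^\- t)%E.
Proof. by rewrite funenegE -EFinN -EFin_max. Qed.

Lemma summable_funrpos u : summableT u -> (esumT u^\+ < +oo)%E.
Proof.
rewrite -ge0_summableE; last exact: funrpos_ge0.
move=> /summable_funepos; congr (summable _ _).
by apply/funext => t; rewrite EFin_funrpos.
Qed.

Lemma summable_funrneg u : summableT u -> (esumT u^\- < +oo)%E.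
Proof.
rewrite -ge0_summableE; last exact: funrneg_ge0.
move=> /summable_funeneg; congr (summable _ _).
by apply/funext => t; rewrite EFin_funrneg.
Qed.

Lemma esum_reindex u (e : T -> T) : bijective e -> esumT (u \o e) = esumT u.
Proof.
move=> e_bij; rewrite [RHS](reindex_esum [set: T] [set: T] e) //.
by rewrite setTT_bijective.
Qed.

End RealFamilies.

Section RealSums.
Variables (R : realType) (G : groupType).
Implicit Types (u v : G -> R) (c : R).
Local Notation esumT u := (\esum_(g in [set: G]) (u g)%:E)%E.
Local Notation summableT u := (summable [set: G] (fun g => (u g)%:E)).

Lemma rsumB u v : (forall g, 0 <= u g) -> (forall g, 0 <= v g) ->
  (esumT u < +oo)%E -> (esumT v < +oo)%E ->
  rsum (u \- v) = fine (esumT u) - fine (esumT v).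
Proof.
move=> u0 v0 u_oo v_oo; have us : summableT u by rewrite ge0_summableE.
have vs : summableT v by rewrite ge0_summableE.
have uvs : summableT (u \- v) := summableB us vs.
have posE : (esumT (u \- v)^\+ = \esum_(g in [set: G]) (EFin \o (u \- v)%R)^\+ g)%E.
  by apply: eq_esum => g _; exact: EFin_funrpos.
have negE : (esumT (u \- v)^\- = \esum_(g in [set: G]) (EFin \o (u \- v)%R)^\- g)%E.
  by apply: eq_esum => g _; exact: EFin_funrneg.
rewrite -fineB ?esum_fin_num // -esumB //; try by move=> g _; rewrite lee_fin.
rewrite fineB -?posE -?negE //.
- by rewrite esum_fin_num ?summable_funrpos // => g; exact: funrpos_ge0.
- by rewrite esum_fin_num ?summable_funrneg // => g; exact: funrneg_ge0.
Qed.

Lemma ge0_rsum u : (forall g, 0 <= u g) -> rsum u = fine (esumT u).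
Proof.
move=> u0; rewrite /rsum [X in _ - fine X]esum1 ?subr0 => [|g _].
  by congr fine; apply: eq_esum => g _; rewrite (@ge0_funrposE _ _ setT) ?inE.
by rewrite (@ge0_funrnegE _ _ setT) ?inE.
Qed.

Lemma rsumN u : rsum (\- u) = - rsum u.
Proof. by rewrite /rsum funrposN funrnegN opprB. Qed.

Lemma rsumZ c u : summableT u -> rsum (fun g => c * u g) = c * rsum u.
Proof.
move=> us; wlog c0 : c / 0 <= c => [wlog_c|].
  have [|c0] := leP 0 c; first exact: wlog_c.
  rewrite -[c]opprK mulNr -wlog_c ?oppr_ge0 ?ltW // -rsumN; congr rsum.
  by apply/funext => g /=; rewrite mulNr.
have pos_fin := esum_fin_num (funrpos_ge0 u) (summable_funrpos us).
have neg_fin := esum_fin_num (funrneg_ge0 u) (summable_funrneg us).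
by rewrite /rsum (ge0_funrposM _ c0) (ge0_funrnegM _ c0) !esumZ // !fineM // -mulrBr.
Qed.

Lemma rsumD u v : summableT u -> summableT v -> rsum (u \+ v) = rsum u + rsum v.
Proof.
move=> us vs.
have upos := summable_funrpos us; have uneg := summable_funrneg us.
have vpos := summable_funrpos vs; have vneg := summable_funrneg vs.
have -> : u \+ v = (u^\+ \+ v^\+) \- (u^\- \+ v^\-).
  rewrite -{1}(funrposBneg u) -{1}(funrposBneg v); apply/funext => g /=.
  by rewrite opprD addrACA.
rewrite rsumB; try by move=> g; rewrite addr_ge0.
- by rewrite !ge0_esumD // !fineD ?esum_fin_num // /rsum opprD addrACA.
- by rewrite ge0_esumD ?lte_add_pinfty.
- by rewrite ge0_esumD ?lte_add_pinfty.
Qed.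

Lemma rsum_reindex u (e : G -> G) : bijective e -> rsum (u \o e) = rsum u.
Proof.
by move=> e_bij; rewrite /rsum -(esum_reindex u^\+ e_bij) -(esum_reindex u^\- e_bij).
Qed.

Lemma rsum_supp1 u x : (forall g, g != x -> u g = 0) -> rsum u = u x.
Proof.
move=> ux; rewrite /rsum !(@esum_supp1 _ _ _ x) //.
- exact: (congr1 (@^~ x) (funrposBneg u)).
- by move=> g /ux ugx; rewrite /funrneg ugx oppr0 maxxx.
- by move=> g /ux ugx; rewrite /funrpos ugx maxxx.
Qed.

End RealSums.

Section ComplexSums.
Variables (R : realType) (G : groupType).
Implicit Types (u v : G -> R[i]) (c : R[i]).

Definition complex_summable u := summable [set: G] (fun g => (normc (u g))%:E).

Lemma summable_Re u : complex_summable u ->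
  summable [set: G] (fun g => (complex.Re (u g))%:E).
Proof.
rewrite /complex_summable (ge0_summableE (fun g => normc_ge0 (u g))).
by apply: le_summable => g; exact: normRe_le_normc.
Qed.

Lemma summable_Im u : complex_summable u ->
  summable [set: G] (fun g => (complex.Im (u g))%:E).
Proof.
rewrite /complex_summable (ge0_summableE (fun g => normc_ge0 (u g))).
by apply: le_summable => g; exact: normIm_le_normc.
Qed.

Lemma csumD u v : complex_summable u -> complex_summable v ->
  csum (u \+ v) = csum u + csum v.
Proof.
move=> us vs; rewrite /csum.
have -> : (fun g => complex.Re ((u \+ v) g)) =
    (fun g => complex.Re (u g)) \+ (fun g => complex.Re (v g)).
  by apply/funext => g; rewrite /= raddfD.
have -> : (fun g => complex.Im ((u \+ v) g)) =
    (fun g => complex.Im (u g)) \+ (fun g => complex.Im (v g)).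
  by apply/funext => g; rewrite /= raddfD.
rewrite (rsumD (summable_Re us) (summable_Re vs)).
by rewrite (rsumD (summable_Im us) (summable_Im vs)).
Qed.

Lemma csumZ c u : complex_summable u -> csum (fun g => c * u g) = c * csum u.
Proof.
move=> us; have usRe := summable_Re us; have usIm := summable_Im us.
case: c => a b; rewrite /csum.
have -> : (fun g => complex.Re ((a +i* b) * u g)) =
    (fun g => a * complex.Re (u g)) \+ (fun g => - b * complex.Im (u g)).
  by apply/funext => g /=; case: (u g) => x y /=; rewrite mulNr.
have -> : (fun g => complex.Im ((a +i* b) * u g)) =
    (fun g => a * complex.Im (u g)) \+ (fun g => b * complex.Re (u g)).
  by apply/funext => g /=; case: (u g).
by rewrite !rsumD ?(summableZ _ usRe) ?(summableZ _ usIm) // !rsumZ // mulNr.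
Qed.

Lemma csum_conj u : csum (fun g => (u g)^*) = (csum u)^*.
Proof.
rewrite /csum /Num.conj /= -rsumN.
by congr Complex; congr rsum; apply/funext => g /=; case: (u g).
Qed.

Lemma csum_reindex u (e : G -> G) : bijective e -> csum (u \o e) = csum u.
Proof.
move=> e_bij; congr Complex.
  exact: (rsum_reindex (fun g => complex.Re (u g)) e_bij).
exact: (rsum_reindex (fun g => complex.Im (u g)) e_bij).
Qed.

Lemma csum_supp1 u x : (forall g, g != x -> u g = 0) -> csum u = u x.
Proof.
move=> ux; rewrite /csum !(@rsum_supp1 _ _ _ x); first by case: (u x).
  by move=> g /ux ->.
by move=> g /ux ->.
Qed.

Lemma csum_real (u : G -> R) : csum (fun g => (u g)%:C) = (rsum u)%:C.
Proof. by congr Complex; exact: (@rsum_supp1 _ _ (fun=> 0) 1%g). Qed.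

End ComplexSums.

(** * The Hilbert space of square summable functions *)

Section DotProduct.
Variables (C : numClosedFieldType) (U : lmodType C) (form : {dot U for Num.conj}).
Implicit Types u v : U.

(* [CauchySchwarz] in the library is stated for finite-dimensional spaces. *)
Lemma dot_CauchySchwarz u v : `|form u v| ^+ 2 <= form u u * form v v.
Proof.
have [->|v0] := eqVneq v 0; first by rewrite linear0r normr0 expr0n mulr_ge0 ?dnorm_ge0.
have fv0 : 0 < form v v by rewrite dnorm_gt0.
pose a := form u v / form v v; pose w := u - a *: v.
have wv : form w v = 0 by rewrite linearBl /= linearZl_LR divfK ?subrr ?gt_eqF.
have -> : u = w + a *: v by rewrite subrK.
rewrite linearDl /= wv add0r linearZl_LR hnormDd /=; last first.
  by rewrite linearZr_LR /= wv mulr0.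
rewrite dnormZ mulrDl normrM exprMn (ger0_norm (ltW fv0)) expr2 mulrA.
by rewrite lerDr mulr_ge0 // dnorm_ge0.
Qed.

Lemma dnorm_sum_orthogonal N (u : 'I_N -> U) :
  (forall j k, j != k -> form (u j) (u k) = 0) ->
  form (\sum_j u j) (\sum_j u j) = \sum_j form (u j) (u j).
Proof.
move=> ortho; rewrite linear_sumlz; apply: eq_bigr => j _.
rewrite linear_sumr (bigD1 j) //= big1 ?addr0 // => k kj.
by rewrite ortho // eq_sym.
Qed.

End DotProduct.

Section Ell2.
Variables (R : realType) (G : groupType).
Local Notation C := R[i].
Implicit Types (f h k : ell2 R G) (g x : G).

Lemma ell2P f h : (forall g, f g = h g) -> f = h.
Proof. by move=> fh; apply/val_inj/funext. Qed.

Lemma ell2DE f h g : (f + h) g = f g + h g. Proof. by []. Qed.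
Lemma ell2NE f g : (- f) g = - f g. Proof. by []. Qed.
Lemma ell2ZE c f g : (c *: f) g = c * f g. Proof. by []. Qed.
Definition ell2E := (ell2DE, ell2NE, ell2ZE).

Lemma ell2_sumE (I : Type) (r : seq I) (F : I -> ell2 R G) g :
  (\sum_(i <- r) F i) g = \sum_(i <- r) F i g.
Proof. by elim/big_rec2: _ => // i x y _ <-. Qed.

Lemma sqnorm_lty f : (sqnorm f < +oo)%E.
Proof. by case: f => f sf; apply/asboolP. Qed.

Lemma ell2_norm_ge0 f : 0 <= ell2_norm f.
Proof. exact: sqrtr_ge0. Qed.

Lemma sqr_ell2_norm f : ell2_norm f ^+ 2 = fine (sqnorm f).
Proof. by rewrite sqr_sqrtr // fine_ge0 // sqnorm_ge0. Qed.

Lemma sqnormE f : sqnorm f = (ell2_norm f ^+ 2)%:E.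
Proof. by rewrite sqr_ell2_norm fineK // ge0_fin_numE ?sqnorm_ge0 // sqnorm_lty. Qed.

Lemma ell2_norm_le f (M : R) : 0 <= M -> (sqnorm f <= (M ^+ 2)%:E)%E ->
  ell2_norm f <= M.
Proof.
move=> M0; rewrite sqnormE lee_fin.
by rewrite ler_pXn2r ?nnegrE ?ell2_norm_ge0.
Qed.

Lemma normc_le_ell2_norm f g : normc (f g) <= ell2_norm f.
Proof.
rewrite -(@ler_pXn2r _ 2) ?nnegrE ?ell2_norm_ge0 ?normc_ge0 // -lee_fin -sqnormE.
by apply: (term_le_esum (u := fun x => normc (f x) ^+ 2)) => x; exact: sqr_ge0.
Qed.

Lemma ell2_norm_eq0 f : ell2_norm f = 0 -> f = 0.
Proof.
move=> f0; apply: ell2P => g; apply: eq0_normc.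
by apply/eqP; rewrite eq_le normc_ge0 -f0 normc_le_ell2_norm.
Qed.

Lemma ell2_eq0_eps f (K : R) :
  (forall e, 0 < e -> ell2_norm f <= e * K) -> f = 0.
Proof.
move=> /le0_of_le_eps f_le0; apply: ell2_norm_eq0.
by apply/eqP; rewrite eq_le f_le0 ell2_norm_ge0.
Qed.

Lemma complex_summable_dot f h : complex_summable (fun g => f g * (h g)^*).
Proof.
apply: (@le_summable _ _ _ (fun g => normc (f g) ^+ 2 + normc (h g) ^+ 2)) => [g|].
  rewrite ger0_norm ?normc_ge0 // normcM normc_conj.
  set a := normc _; set b := normc _; rewrite -subr_ge0.
  have -> : a ^+ 2 + b ^+ 2 - a * b = (a - b) ^+ 2 + a * b by ring.
  by rewrite addr_ge0 ?sqr_ge0 // mulr_ge0 ?normc_ge0.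
by rewrite ge0_esumD ?lte_add_pinfty ?sqnorm_lty // => g; exact: sqr_ge0.
Qed.

Fact ell2_dotC f h : ell2_dot f h = (ell2_dot h f)^*.
Proof.
rewrite /ell2_dot -csum_conj; congr csum; apply/funext => g.
by rewrite rmorphM /= conjCK mulrC.
Qed.

Fact ell2_dotPl c f h k : ell2_dot (c *: f + h) k = c * ell2_dot f k + ell2_dot h k.
Proof.
rewrite /ell2_dot -(csumZ _ (complex_summable_dot f k)).
have -> : (fun g => c * (f g * (k g)^*)) = (fun g => (c *: f) g * (k g)^*).
  by apply/funext => g; rewrite ell2ZE mulrA.
rewrite -(csumD (complex_summable_dot (c *: f) k) (complex_summable_dot h k)).
by congr csum; apply/funext => g; rewrite ell2DE mulrDl.
Qed.

Fact ell2_dot_bilinear :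
  bilinear_for (GRing.Scale.Law.clone _ _ *%R _)
    (GRing.Scale.Law.clone _ _ (Num.conj \; *%R) _) (@ell2_dot R G).
Proof.
split=> [k c f h|k c f h]; first exact: ell2_dotPl.
by rewrite ell2_dotC ell2_dotPl rmorphD rmorphM /= -!ell2_dotC.
Qed.

HB.instance Definition _ := bilinear_isBilinear.Build C (ell2 R G) (ell2 R G) C
  _ _ (@ell2_dot R G) ell2_dot_bilinear.

Lemma dotff f : ell2_dot f f = (ell2_norm f ^+ 2)%:C.
Proof.
rewrite sqr_ell2_norm -ge0_rsum => [|g]; last exact: sqr_ge0.
rewrite -csum_real; congr csum; apply/funext => g.
by rewrite -normCK rmorphXn.
Qed.

Fact ell2_dot_hermitian f h : ell2_dot f h = (-1) ^+ false * (ell2_dot h f)^*.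
Proof. by rewrite expr0 mul1r ell2_dotC. Qed.

HB.instance Definition _ := isHermitianSesquilinear.Build C (ell2 R G) false Num.conj
  (@ell2_dot R G) ell2_dot_hermitian.

Fact ell2_dot_definite f : f != 0 -> 0 < ell2_dot f f.
Proof.
move=> f0; rewrite dotff ltcR exprn_gt0 // lt_neqAle ell2_norm_ge0 andbT eq_sym.
by apply: contra_neq f0; exact: ell2_norm_eq0.
Qed.

HB.instance Definition _ := isDotProduct.Build C (ell2 R G)
  (@ell2_dot R G) ell2_dot_definite.

Lemma normc_dot_le f h : normc (ell2_dot f h) <= ell2_norm f * ell2_norm h.
Proof.
rewrite -(@ler_pXn2r _ 2) ?nnegrE ?mulr_ge0 ?normc_ge0 ?ell2_norm_ge0 //.
have /= := dot_CauchySchwarz (@ell2_dot R G) f h.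
by rewrite !dotff -rmorphM -exprMn -rmorphXn lecR.
Qed.

Lemma sqr_ell2_norm_dot f : ell2_norm f ^+ 2 = complex.Re (ell2_dot f f).
Proof. by rewrite dotff. Qed.

Lemma ell2_norm0 : ell2_norm (0 : ell2 R G) = 0.
Proof. by apply/eqP; rewrite -sqrf_eq0 sqr_ell2_norm_dot linear0l. Qed.

Lemma ell2_normZ c f : ell2_norm (c *: f) = normc c * ell2_norm f.
Proof.
apply: (@pexpIrn _ 2); rewrite ?nnegrE ?mulr_ge0 ?ell2_norm_ge0 ?normc_ge0 //.
have /= := dnormZ (@ell2_dot R G) c f.
by rewrite !dotff -rmorphXn -rmorphM exprMn => /complexI.
Qed.

Lemma ell2_normN f : ell2_norm (- f) = ell2_norm f.
Proof.
by rewrite -scaleN1r ell2_normZ (normcN (1 : Rcomplex R)) normc1 mul1r.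
Qed.

Lemma ell2_normD f h : ell2_norm (f + h) <= ell2_norm f + ell2_norm h.
Proof.
rewrite -(@ler_pXn2r _ 2) ?nnegrE ?addr_ge0 ?ell2_norm_ge0 // sqrrD.
have re_le := le_trans (le_trans (ler_norm _) (normRe_le_normc _)) (normc_dot_le f h).
have /= := dnormD (@ell2_dot R G) f h; rewrite !dotff => /(congr1 (@complex.Re R)).
by case: (ell2_dot f h) re_le => a b /= a_le ->; lra.
Qed.

Lemma ell2_normB f h : ell2_norm (f - h) <= ell2_norm f + ell2_norm h.
Proof. by rewrite -(ell2_normN h) ell2_normD. Qed.

Lemma ell2_norm_sum (I : Type) (r : seq I) (F : I -> ell2 R G) :
  ell2_norm (\sum_(i <- r) F i) <= \sum_(i <- r) ell2_norm (F i).
Proof.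
elim/big_rec2: _ => [|i x y _ xy]; first by rewrite ell2_norm0.
by apply: le_trans (ell2_normD _ _) _; rewrite lerD2l.
Qed.

Lemma left_regularE x f g : left_regular x f g = f (x^-1 * g)%g.
Proof. by []. Qed.

Lemma left_regular1 : @left_regular R G 1%g = idfun.
Proof. by apply: funext => f; apply: ell2P => g; rewrite left_regularE invg1 mul1g. Qed.

Lemma left_regularM x y :
  @left_regular R G (x * y)%g = left_regular x \o left_regular y.
Proof. by apply: funext => f; apply: ell2P => g; rewrite !left_regularE invgM -mulgA. Qed.

Lemma left_regular_comp x y f :
  left_regular x (left_regular y f) = left_regular (x * y)%g f.
Proof. by rewrite left_regularM. Qed.

Lemma left_regular_linear x : linear (@left_regular R G x).
Proof. by move=> c f h; apply: ell2P. Qed.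

HB.instance Definition _ x := GRing.isLinear.Build C (ell2 R G) (ell2 R G) _
  (left_regular x) (left_regular_linear x).

Lemma mulg_bijl x : bijective (fun g => x * g)%g.
Proof. by exists (fun g => x^-1 * g)%g => g; rewrite (mulKg, mulVKg). Qed.

Lemma mulg_bijr x : bijective (fun g => g * x)%g.
Proof. by exists (fun g => g * x^-1)%g => g; rewrite (mulgK, mulgVK). Qed.

Lemma adjoint_left_regular x : adjoint (@left_regular R G x) (left_regular x^-1%g).
Proof.
move=> f h; rewrite /ell2_dot -(csum_reindex _ (mulg_bijl x)); congr csum.
by apply/funext => g /=; rewrite !left_regularE mulKg invgK.
Qed.

Lemma left_regular_norm x f : ell2_norm (left_regular x f) = ell2_norm f.
Proof.
apply: (@pexpIrn _ 2); rewrite ?nnegrE ?ell2_norm_ge0 //.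
rewrite !sqr_ell2_norm_dot adjoint_left_regular.
by rewrite left_regular_comp mulVg left_regular1.
Qed.

Fact right_translate_subproof x f :
  (fun g => f (g * x)%g) \in square_summable (R := R) (G := G).
Proof.
apply/asboolP; have := sqnorm_lty f; congr (_ < _)%E.
by rewrite /sqnorm -(esum_reindex _ (mulg_bijr x)).
Qed.

Definition right_translate x f : ell2 R G := Ell2 (right_translate_subproof x f).

Lemma right_translateE x f g : right_translate x f g = f (g * x)%g.
Proof. by []. Qed.

Lemma right_translate_norm x f : ell2_norm (right_translate x f) = ell2_norm f.
Proof. by rewrite /ell2_norm /sqnorm -[in RHS](esum_reindex _ (mulg_bijr x)). Qed.

Fact delta_subproof x : (fun g => (g == x)%:R : C) \in square_summable (R := R) (G := G).
Proof.
apply/asboolP; rewrite /sqnorm (esum_supp1 (x := x)) ?ltry // => g; first exact: sqr_ge0.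
by move=> /negPf ->; rewrite normc_natr expr0n.
Qed.

Definition delta x : ell2 R G := Ell2 (delta_subproof x).

Lemma deltaE x g : delta x g = (g == x)%:R. Proof. by []. Qed.

Lemma left_regular_delta x y : left_regular x (delta y) = delta (x * y)%g.
Proof.
by apply: ell2P => g; rewrite left_regularE !deltaE -(inj_eq (mulgI x)) mulVKg.
Qed.

Lemma right_translate_delta x y : right_translate x (delta y) = delta (y * x^-1)%g.
Proof.
by apply: ell2P => g; rewrite right_translateE !deltaE -(inj_eq (mulIg x) g) mulgVK.
Qed.

Lemma dot_delta f x : ell2_dot f (delta x) = f x.
Proof.
rewrite /ell2_dot (@csum_supp1 _ _ _ x) => [|g /negPf gx].
  by rewrite deltaE eqxx rmorph1 mulr1.
by rewrite deltaE gx rmorph0 mulr0.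
Qed.

Lemma delta_norm x : ell2_norm (delta x) = 1.
Proof.
apply: (@pexpIrn _ 2); rewrite ?nnegrE ?ell2_norm_ge0 //.
by rewrite sqr_ell2_norm_dot dot_delta deltaE eqxx expr1n.
Qed.

Fact restr_subproof (D : set G) f :
  (fun g => if g \in D then f g else 0 : C) \in square_summable (R := R) (G := G).
Proof.
apply/asboolP; apply: le_lt_trans (sqnorm_lty f).
apply: le_esum => g _; rewrite lee_fin; case: ifP => // _.
by rewrite normc0 expr0n sqr_ge0.
Qed.

Definition restr (D : set G) f : ell2 R G := Ell2 (restr_subproof D f).

Lemma restrE D f g : restr D f g = if g \in D then f g else 0.
Proof. by []. Qed.

Lemma restr_linear D : linear (restr D).
Proof.
move=> c f h; apply: ell2P => g; rewrite !(restrE, ell2E).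
by case: ifP; rewrite // mulr0 addr0.
Qed.

HB.instance Definition _ D := GRing.isLinear.Build C (ell2 R G) (ell2 R G) _
  (restr D) (restr_linear D).

Lemma restrC D f : restr D f + restr (~` D) f = f.
Proof.
apply: ell2P => g; rewrite ell2DE !restrE in_setC.
by case: (g \in D); rewrite ?addr0 ?add0r.
Qed.

Lemma restr_comp D E f : restr D (restr E f) = restr (D `&` E) f.
Proof. by apply: ell2P => g; rewrite !restrE in_setI; do 2 case: (g \in _). Qed.

Lemma restr0 f : restr set0 f = 0.
Proof. by apply: ell2P => g; rewrite restrE in_set0. Qed.

Lemma adjoint_restr D : adjoint (restr D) (restr D).
Proof.
move=> f h; congr csum; apply/funext => g; rewrite !restrE.
by case: ifP; rewrite // rmorph0 mul0r mulr0.
Qed.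

Lemma restr_norm D f : ell2_norm (restr D f) <= ell2_norm f.
Proof.
apply: ell2_norm_le; rewrite ?ell2_norm_ge0 // -sqnormE.
apply: le_esum => g _; rewrite lee_fin restrE; case: ifP => // _.
by rewrite normc0 expr0n sqr_ge0.
Qed.

Lemma left_regular_restr x D f :
  left_regular x (restr D f) = restr (translate x D) (left_regular x f).
Proof.
apply: ell2P => g; rewrite left_regularE !restrE left_regularE.
congr (if _ then _ else _); apply/idP/idP => /set_mem; last first.
  by move=> [d Dd <-]; rewrite mulKg mem_set.
by move=> Dg; apply/mem_set; exists (x^-1 * g)%g; rewrite // mulVKg.
Qed.

Section DisjointSupports.
Variables (N : nat) (D : 'I_N -> set G).
Hypothesis disjointD : forall j k : 'I_N, j != k -> D j `&` D k = set0.

Lemma sqr_norm_sum_restr (F : 'I_N -> ell2 R G) :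
  ell2_norm (\sum_j restr (D j) (F j)) ^+ 2 = \sum_j ell2_norm (restr (D j) (F j)) ^+ 2.
Proof.
apply: (@complexI R); rewrite -dotff rmorph_sum /=.
under [RHS]eq_bigr do rewrite -dotff.
apply: (dnorm_sum_orthogonal (form := @ell2_dot R G)) => j k jk /=.
by rewrite adjoint_restr restr_comp disjointD // restr0 linear0r.
Qed.

Lemma sum_sqr_norm_restr f : \sum_j ell2_norm (restr (D j) f) ^+ 2 <= ell2_norm f ^+ 2.
Proof.
rewrite -sqr_norm_sum_restr ler_pXn2r ?nnegrE ?ell2_norm_ge0 //.
set w := \sum_j _; have dot_fw : ell2_dot f w = (ell2_norm w ^+ 2)%:C.
  rewrite sqr_norm_sum_restr linear_sumr rmorph_sum; apply: eq_bigr => j _ /=.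
  by rewrite -dotff adjoint_restr restr_comp setIid.
have [->|w0] := eqVneq (ell2_norm w) 0; first exact: ell2_norm_ge0.
have w_gt0 : 0 < ell2_norm w by rewrite lt_neqAle eq_sym w0 ell2_norm_ge0.
rewrite -(ler_pM2r w_gt0) -expr2 -[leLHS]ger0_norm ?sqr_ge0 //.
by rewrite -normc_real -dot_fw normc_dot_le.
Qed.

End DisjointSupports.
End Ell2.

Section Completeness.
Variables (R : realType) (G : groupType).

Lemma cvg_sqr_normcB (u : nat -> R[i]) (a b : R) (z : R[i]) :
  complex.Re (u n) @[n --> \oo] --> a -> complex.Im (u n) @[n --> \oo] --> b ->
  normc (u n - z) ^+ 2 @[n --> \oo] --> normc (a +i* b - z) ^+ 2.
Proof.
move=> u_a u_b; rewrite sqr_normcE !raddfB.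
rewrite (_ : (fun n => normc (u n - z) ^+ 2) = (fun n =>
    (complex.Re (u n) - complex.Re z) ^+ 2 + (complex.Im (u n) - complex.Im z) ^+ 2)).
  apply: cvgD; apply: cvgM; apply: cvgB => //; exact: cvg_cst.
by apply/funext => n; rewrite sqr_normcE !raddfB.
Qed.

Lemma sqnorm_lower_semicontinuous (f : nat -> G -> R[i]) (l : G -> R[i]) (M : R) :
  (forall g, normc (f n g) ^+ 2 @[n --> \oo] --> normc (l g) ^+ 2) ->
  (\forall n \near \oo, (sqnorm (f n) <= M%:E)%E) -> (sqnorm l <= M%:E)%E.
Proof.
move=> f_l f_le; apply: ge_ereal_sup => _ [A [finA _] <-].
rewrite fsbig_finite // sumEFin lee_fin; set s := finmap.enum_fset _.
have sum_cvg : \sum_(g <- s) normc (f n g) ^+ 2 @[n --> \oo] -->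
    \sum_(g <- s) normc (l g) ^+ 2.
  by apply: cvg_big => // -[x y]; exact: add_continuous.
apply: cvgr_to_le sum_cvg _; apply: filterS f_le => n fn_le.
rewrite -lee_fin -sumEFin -fsbig_finite //; apply: le_trans fn_le.
by apply: esum_ge; exists A.
Qed.

Lemma ell2_dist_geometric (f : nat -> ell2 R G) (c : R) m n : (m <= n)%N ->
  (forall n, ell2_norm (f n.+1 - f n) <= c * 2^-1 ^+ n) ->
  ell2_norm (f n - f m) <= 2 * c * 2^-1 ^+ m.
Proof.
move=> mn f_le; have c0 : 0 <= c.
  by have := le_trans (ell2_norm_ge0 _) (f_le 0%N); rewrite expr0 mulr1.
apply: (@le_trans _ _ (2 * c * (2^-1 ^+ m - 2^-1 ^+ n))); last first.
  by rewrite ler_wpM2l ?mulr_ge0 // gerBl exprn_ge0 // invr_ge0.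
rewrite -(subnKC mn); elim: (n - m)%N => [|k IH].
  by rewrite addn0 !subrr ell2_norm0 mulr0.
rewrite addnS -(subrK (f (m + k)%N) (f (m + k).+1)) -addrA.
apply: le_trans (ell2_normD _ _) _; apply: le_trans (lerD (f_le _) IH) _.
by rewrite exprS; lra.
Qed.

Lemma ell2_complete (f : nat -> ell2 R G) (c : R) :
  (forall n, ell2_norm (f n.+1 - f n) <= c * 2^-1 ^+ n) ->
  exists l, forall n, ell2_norm (l - f n) <= 2 * c * 2^-1 ^+ n.
Proof.
move=> f_le; have coord_cvg (p : {additive R[i] -> R}) g :
    (forall z, `|p z| <= normc z) -> cvgn (fun n => p (f n g)).
  move=> p_le; apply: (is_cvg_geometric_increments (normr_half_lt1 R) (c := c)) => n.
  rewrite -raddfB; apply: le_trans (p_le _) (le_trans _ (f_le n)).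
  exact: (normc_le_ell2_norm (f n.+1 - f n)).
pose a g := limn (fun n => complex.Re (f n g)).
pose b g := limn (fun n => complex.Im (f n g)).
have c0 : 0 <= c.
  by have := le_trans (ell2_norm_ge0 _) (f_le 0%N); rewrite expr0 mulr1.
have dist_le n : (sqnorm (fun g => (a g +i* b g) - f n g)%R <=
    ((2 * c * 2^-1 ^+ n) ^+ 2)%:E)%E.
  apply: (@sqnorm_lower_semicontinuous (fun k => ell2_fun (f k - f n))) => [g|].
    apply: (cvg_sqr_normcB (u := fun k => f k g)).
      exact: (coord_cvg (@complex.Re R) g (@normRe_le_normc R)).
    exact: (coord_cvg (@complex.Im R) g (@normIm_le_normc R)).
  exists n => // k /= nk; rewrite (sqnormE (f k - f n)) lee_fin.
  rewrite ler_pXn2r ?nnegrE ?ell2_norm_ge0 //; first exact: ell2_dist_geometric.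
  by rewrite !mulr_ge0 ?exprn_ge0 ?invr_ge0.
have l0_summable :
    (fun g => (a g +i* b g) - f 0%N g) \in square_summable (R := R) (G := G).
  by apply/asboolP; apply: le_lt_trans (dist_le 0%N) (ltry _).
exists (Ell2 l0_summable + f 0%N) => n; apply: ell2_norm_le.
  by rewrite !mulr_ge0 ?exprn_ge0 ?invr_ge0.
apply: le_trans (dist_le n); apply: le_esum => g _.
by rewrite !ell2DE /= subrK.
Qed.

End Completeness.

(** * The reduced C*-algebra *)

Section Operators.
Variables (R : realType) (G : groupType).
Local Notation op := (ell2 R G -> ell2 R G).
Implicit Types (f h : ell2 R G) (S T : op) (M : R).

Lemma opDE S T f : (S + T) f = S f + T f. Proof. by []. Qed.
Lemma opNE T f : (- T) f = - T f. Proof. by []. Qed.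
Lemma opZE c T f : (c *: T) f = c *: T f. Proof. by []. Qed.
Definition opE := (opDE, opNE, opZE).

Lemma op_sumE (I : Type) (r : seq I) (F : I -> op) f :
  (\sum_(i <- r) F i) f = \sum_(i <- r) F i f.
Proof. by elim/big_rec2: _ => // i x y _ <-. Qed.

Definition opnorm_le T M := forall f, ell2_norm (T f) <= M * ell2_norm f.

Lemma opnorm_le_ge0 T M : opnorm_le T M -> 0 <= M.
Proof.
by move=> /(_ (delta R 1%g)); rewrite delta_norm mulr1; exact/le_trans/ell2_norm_ge0.
Qed.

Lemma opnorm_leW T M M' : M <= M' -> opnorm_le T M -> opnorm_le T M'.
Proof.
by move=> MM' TM f; apply: le_trans (TM f) _; rewrite ler_wpM2r ?ell2_norm_ge0.
Qed.

Lemma opnorm_leD S T M M' : opnorm_le S M -> opnorm_le T M' -> opnorm_le (S + T) (M + M').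
Proof. by move=> SM TM f; rewrite (le_trans (ell2_normD _ _)) // mulrDl lerD. Qed.

Lemma opnorm_leZ c T M : opnorm_le T M -> opnorm_le (c *: T) (normc c * M).
Proof. by move=> TM f; rewrite opE ell2_normZ -mulrA ler_wpM2l ?normc_ge0. Qed.

Lemma opnorm_leN T M : opnorm_le T M -> opnorm_le (- T) M.
Proof. by move=> TM f; rewrite opE ell2_normN. Qed.

Lemma opnorm_leB S T M M' : opnorm_le S M -> opnorm_le T M' -> opnorm_le (S - T) (M + M').
Proof. by move=> SM TM; apply: opnorm_leD => //; exact: opnorm_leN. Qed.

Lemma opnorm_le_comp S T M M' : opnorm_le S M -> opnorm_le T M' ->
  opnorm_le (S \o T) (M * M').
Proof.
move=> SM TM f; apply: le_trans (SM _) _.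
by rewrite -mulrA ler_wpM2l // (opnorm_le_ge0 SM).
Qed.

Lemma opnorm_le_sqrB S T M M' : linear S -> opnorm_le S M -> opnorm_le T M ->
  opnorm_le (S - T) M' -> opnorm_le ((S \o S) - (T \o T)) (2 * M * M').
Proof.
move=> lS SM TM STM'.
have -> : (S \o S) - (T \o T) = (S \o (S - T)) + ((S - T) \o T).
  by apply/funext => f; rewrite !opE /= (zmod_morphism_linear lS) addrA subrK.
apply: opnorm_leW (opnorm_leD (opnorm_le_comp SM STM') (opnorm_le_comp STM' TM)).
by lra.
Qed.

Lemma opnorm_le0 : opnorm_le 0 0.
Proof. by move=> f; rewrite mul0r [X in ell2_norm X](_ : _ = 0) // ell2_norm0. Qed.

Lemma opnorm_le_id : opnorm_le idfun 1.
Proof. by move=> f; rewrite mul1r. Qed.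

Lemma opnorm_le_left_regular g : opnorm_le (left_regular g) 1.
Proof. by move=> f; rewrite left_regular_norm mul1r. Qed.

Lemma opnorm_le_lim T M :
  (forall e, 0 < e -> exists2 S, opnorm_le S M & opnorm_le (T - S) e) ->
  opnorm_le T M.
Proof.
move=> T_lim f; rewrite -subr_le0; apply: (@le0_of_le_eps _ _ (ell2_norm f)) => e e0.
have [S SM TS] := T_lim e e0.
rewrite lerBlDr -[T](subrK S); apply: le_trans (ell2_normD _ _) _.
exact: lerD (TS f) (SM f).
Qed.

Lemma op_eq_lim S T (K : R) : (forall e, 0 < e -> opnorm_le (S - T) (K * e)) -> S = T.
Proof.
move=> ST; apply/eqP; rewrite -subr_eq0; apply/eqP/funext => f.
apply: (@ell2_eq0_eps _ _ _ (K * ell2_norm f)) => e e0.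
by rewrite mulrA [e * K]mulrC; exact: ST.
Qed.

Lemma linear_lim T (K : R) :
  (forall e, 0 < e -> exists2 S, linear S & opnorm_le (T - S) (K * e)) -> linear T.
Proof.
move=> T_lim c f h; apply/eqP; rewrite -subr_eq0; apply/eqP.
apply: (@ell2_eq0_eps _ _ _
  (K * (ell2_norm (c *: f + h) + (normc c * ell2_norm f + ell2_norm h)))) => e e0.
have [S lS TS] := T_lim e e0.
have -> : T (c *: f + h) - (c *: T f + T h) =
    (T - S) (c *: f + h) - (c *: (T - S) f + (T - S) h).
  by rewrite !opE lS; apply: ell2P => g; rewrite !ell2E; ring.
apply: le_trans (ell2_normB _ _) _; rewrite mulrA [e * K]mulrC mulrDr.
apply: lerD (TS _) (le_trans (ell2_normD _ _) _); rewrite mulrDr.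
by apply: lerD (TS _); rewrite ell2_normZ mulrCA ler_wpM2l ?normc_ge0.
Qed.

Lemma adjoint_sym S T : adjoint T S -> adjoint S T.
Proof. by move=> TS f h; rewrite ell2_dotC -TS -ell2_dotC. Qed.

Lemma adjoint_lin c S T S' T' : adjoint T S -> adjoint T' S' ->
  adjoint (c *: T + T') (c^* *: S + S').
Proof.
move=> TS TS' f h; rewrite !opE linearDl linearDr linearZl_LR linearZr_LR /= TS TS'.
by rewrite conjCK.
Qed.

Lemma adjoint_comp S T S' T' : adjoint T S -> adjoint T' S' ->
  adjoint (T \o T') (S' \o S).
Proof. by move=> TS TS' f h; rewrite /= TS TS'. Qed.

Lemma adjoint0 : adjoint (0 : op) 0.
Proof. by move=> f h; rewrite linear0l linear0r. Qed.

Lemma adjointZ c S T : adjoint T S -> adjoint (c *: T) (c^* *: S).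
Proof.
by move=> TS; rewrite -[c *: T]addr0 -[_ *: S]addr0; exact: adjoint_lin adjoint0.
Qed.

Lemma adjointD S T S' T' : adjoint T S -> adjoint T' S' -> adjoint (T + T') (S + S').
Proof.
by move=> TS TS'; have := adjoint_lin 1 TS TS'; rewrite rmorph1 !scale1r.
Qed.

Lemma adjointB S T S' T' : adjoint T S -> adjoint T' S' -> adjoint (T - T') (S - S').
Proof.
move=> TS TS'; apply: adjointD => //.
by have := adjointZ (-1) TS'; rewrite rmorphN1 !scaleN1r.
Qed.

Lemma adjoint_opnorm_le S T M : adjoint T S -> opnorm_le T M -> opnorm_le S M.
Proof.
move=> TS TM f; have [->|Sf0] := eqVneq (ell2_norm (S f)) 0.
  by rewrite mulr_ge0 ?ell2_norm_ge0 // (opnorm_le_ge0 TM).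
have Sf_gt0 : 0 < ell2_norm (S f) by rewrite lt_neqAle eq_sym Sf0 ell2_norm_ge0.
rewrite -(ler_pM2r Sf_gt0) -expr2 -[leLHS]ger0_norm ?sqr_ge0 // -normc_real -dotff -TS.
by apply: le_trans (normc_dot_le _ _) _; rewrite mulrAC ler_wpM2r ?ell2_norm_ge0.
Qed.

Lemma adjoint_lim S T (K : R) :
  (forall e, 0 < e -> exists S' T', [/\ adjoint T' S', opnorm_le (T - T') (K * e) &
     opnorm_le (S - S') (K * e)]) -> adjoint T S.
Proof.
move=> TS_lim f h; apply/eqP; rewrite -subr_eq0; apply/eqP.
apply: (@normc_eq0_eps _ _ (2 * K * ell2_norm f * ell2_norm h)) => e e0.
have [S' [T' [TS' TT' SS']]] := TS_lim e e0.
have -> : ell2_dot (T f) h - ell2_dot f (S h) =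
    ell2_dot ((T - T') f) h - ell2_dot f ((S - S') h).
  by rewrite !opE linearBl linearBr /= TS' opprB addrA subrK.
apply: le_trans (normc_leB _ _) _.
have := le_trans (normc_dot_le ((T - T') f) h) (ler_wpM2r (ell2_norm_ge0 h) (TT' f)).
have := le_trans (normc_dot_le f ((S - S') h)) (ler_wpM2l (ell2_norm_ge0 f) (SS' h)).
by lra.
Qed.

Lemma op_complete (T : nat -> op) (c : R) :
  (forall n, linear (T n)) -> (forall n, opnorm_le (T n.+1 - T n) (c * 2^-1 ^+ n)) ->
  exists2 L, linear L & forall n, opnorm_le (L - T n) (2 * c * 2^-1 ^+ n).
Proof.
move=> lT T_le.
have Tf_le f n : ell2_norm (T n.+1 f - T n f) <= c * ell2_norm f * 2^-1 ^+ n.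
  by rewrite mulrAC; exact: T_le.
have /choice[L L_le] := fun f => ell2_complete (Tf_le f).
have {}L_le n : opnorm_le (L - T n) (2 * c * 2^-1 ^+ n).
  by move=> f; apply: le_trans (L_le f n) _; lra.
exists L => //; apply: (@linear_lim _ 1) => e e0.
have [n n_lt] := geometric_lt (2 * c) (normr_half_lt1 R) e0.
by exists (T n); rewrite ?mul1r //; exact: opnorm_leW (ltW n_lt) (L_le n).
Qed.

End Operators.

Section ReducedCstar.
Variables (R : realType) (G : groupType).
Local Notation C := R[i].
Local Notation op := (ell2 R G -> ell2 R G).
Local Notation span := (@left_regular_span R G).
Local Notation A := (@reduced_Cstar R G).
Local Notation lam := (@left_regular R G).
Implicit Types (f h : ell2 R G) (S T : op) (M : R).

Lemma span_ind (P : op -> Prop) : P 0 ->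
  (forall c g T, span T -> P T -> P (c *: lam g + T)) -> forall T, span T -> P T.
Proof.
move=> P0 Pstep _ [s ->]; elim: s => [|p s IH]; first by rewrite big_nil.
by rewrite big_cons; apply: Pstep => //; exists s.
Qed.

Lemma span0 : span 0. Proof. by exists [::]; rewrite big_nil. Qed.

Lemma span_cons c g T : span T -> span (c *: lam g + T).
Proof. by case=> s ->; exists ((c, g) :: s); rewrite big_cons. Qed.

Lemma span_left_regular g : span (lam g).
Proof. by rewrite -[lam g]addr0 -[lam g]scale1r; exact: span_cons span0. Qed.

Lemma span_lin c S T : span S -> span T -> span (c *: S + T).
Proof.
move=> sS sT; elim/span_ind: S / sS => [|d g S _ IH]; first by rewrite scaler0 add0r.
by rewrite scalerDr scalerA -addrA; exact: span_cons.
Qed.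

Lemma span_linear T : span T -> linear T.
Proof.
elim/span_ind => [|d g S _ IH] c f h; first by rewrite /= !addr0 scaler0.
rewrite !opE IH linearP; apply: ell2P => x; rewrite !ell2E; ring.
Qed.

Lemma span_bounded T : span T -> exists M, opnorm_le T M.
Proof.
elim/span_ind => [|c g S _ [M SM]]; first by exists 0; exact: opnorm_le0.
exists (normc c * 1 + M).
exact: opnorm_leD (opnorm_leZ _ (opnorm_le_left_regular g)) SM.
Qed.

Lemma span_adjoint T : span T -> exists2 S, span S & adjoint T S.
Proof.
elim/span_ind => [|c g S _ [S' sS' SS']].
  by exists 0; [exact: span0|exact: adjoint0].
exists (c^* *: lam g^-1%g + S'); first exact: span_cons.
exact: adjoint_lin (adjoint_left_regular g) SS'.
Qed.

Lemma span_left_regular_comp g T : span T -> span (lam g \o T).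
Proof.
elim/span_ind => [|c x S _ IH].
  rewrite (_ : lam g \o 0 = 0); first exact: span0.
  by apply/funext => f; exact: linear0.
rewrite (_ : _ \o _ = c *: lam (g * x)%g + (lam g \o S)); first exact: span_cons.
by apply/funext => f; rewrite left_regularM !opE /= linearP.
Qed.

Lemma Cstar_linear T : A T -> linear T. Proof. by case=> [[]]. Qed.

Lemma Cstar_bounded T : A T -> exists M, opnorm_le T M.
Proof. by case=> [[]]. Qed.

Lemma Cstar_approx T (e : R) : A T -> 0 < e -> exists2 S, span S & opnorm_le (T - S) e.
Proof. by case=> _ /[apply] -[S [sS TS]]; exists S. Qed.

Lemma Cstar_span T : span T -> A T.
Proof.
move=> sT; split; first by split; [exact: span_linear|exact: span_bounded].
move=> e e0; exists T; split=> // f.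
by rewrite subrr ell2_norm0 mulr_ge0 ?ell2_norm_ge0 // ltW.
Qed.

Lemma Cstar_lim T (K : R) : linear T ->
  (forall e, 0 < e -> exists2 S, A S & opnorm_le (T - S) (K * e)) -> A T.
Proof.
move=> lT T_lim; split.
  split=> //; have [S AS TS] := T_lim 1 ltr01; have [M SM] := Cstar_bounded AS.
  by exists (K * 1 + M); rewrite -[T](subrK S); exact: opnorm_leD.
move=> e e0; have K0 : 0 <= K.
  by have [S _ /opnorm_le_ge0] := T_lim 1 ltr01; rewrite mulr1.
have K1 : 0 < K + 1 by rewrite ltr_wpDl.
have [S AS TS] := T_lim _ (divr_gt0 e0 K1).
have [S' sS' SS'] := Cstar_approx AS (divr_gt0 e0 K1).
exists S'; split=> // f.
have -> : T f - S' f = (T - S + (S - S')) f by rewrite addrA subrK.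
apply: opnorm_leW (opnorm_leD TS SS') f.
by rewrite -[X in _ + X]mul1r -mulrDl mulrC divfK // gt_eqF.
Qed.

Lemma Cstar_left_regular g : A (lam g). Proof. exact/Cstar_span/span_left_regular. Qed.

Lemma Cstar_id : A idfun.
Proof. by rewrite -left_regular1; exact: Cstar_left_regular. Qed.

Lemma Cstar0 : A 0. Proof. exact/Cstar_span/span0. Qed.

Lemma Cstar_lin c S T : A S -> A T -> A (c *: S + T).
Proof.
move=> AS AT; apply: (@Cstar_lim _ (normc c + 1)) => [d f h|e e0].
  rewrite !opE (Cstar_linear AS) (Cstar_linear AT).
  by apply: ell2P => g; rewrite !ell2E; ring.
have [S' sS' SS'] := Cstar_approx AS e0; have [T' sT' TT'] := Cstar_approx AT e0.
exists (c *: S' + T'); first exact/Cstar_span/span_lin.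
have -> : c *: S + T - (c *: S' + T') = c *: (S - S') + (T - T').
  by rewrite opprD addrACA scalerBr.
by rewrite mulrDl mul1r; exact: opnorm_leD (opnorm_leZ _ SS') TT'.
Qed.

Lemma CstarZ c T : A T -> A (c *: T).
Proof. by move=> AT; rewrite -[_ *: _]addr0; exact: Cstar_lin AT Cstar0. Qed.

Lemma CstarD S T : A S -> A T -> A (S + T).
Proof. by move=> AS AT; rewrite -[S]scale1r; exact: Cstar_lin. Qed.

Lemma CstarB S T : A S -> A T -> A (S - T).
Proof. by move=> AS AT; rewrite addrC -scaleN1r; exact: Cstar_lin. Qed.

Lemma Cstar_sum (I : Type) (r : seq I) (F : I -> op) :
  (forall i, A (F i)) -> A (\sum_(i <- r) F i).
Proof.
move=> AF; elim: r => [|i r IH]; first by rewrite big_nil; exact: Cstar0.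
by rewrite big_cons; exact: (CstarD (AF i) IH).
Qed.

Lemma Cstar_comp S T : A S -> A T -> A (S \o T).
Proof.
move=> AS AT; have [M TM] := Cstar_bounded AT.
have Cstar_lam_comp g : A (lam g \o T).
  apply: (@Cstar_lim _ 1) => [c f h|e e0] /=; first by rewrite (Cstar_linear AT) linearP.
  have [T' sT' TT'] := Cstar_approx AT e0.
  exists (lam g \o T'); first exact/Cstar_span/span_left_regular_comp.
  rewrite (_ : _ - _ = lam g \o (T - T')).
    exact: opnorm_le_comp (opnorm_le_left_regular g) TT'.
  by apply/funext => f; rewrite !opE /= linearB.
have Cstar_span_comp S' : span S' -> A (S' \o T).
  elim/span_ind => [|c g U _ IH]; first exact: Cstar0.
  exact: Cstar_lin (Cstar_lam_comp g) IH.
apply: (@Cstar_lim _ M) => [c f h|e e0] /=.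
  by rewrite (Cstar_linear AT) (Cstar_linear AS).
have [S' sS' SS'] := Cstar_approx AS e0; exists (S' \o T); first exact: Cstar_span_comp.
by rewrite mulrC; exact: opnorm_le_comp SS' TM.
Qed.

Lemma Cstar_functional_eq0 (phi : op -> C) (K : R) :
  (forall c S T, A S -> A T -> phi (c *: S + T) = c * phi S + phi T) ->
  (forall T M, A T -> opnorm_le T M -> normc (phi T) <= M * K) ->
  (forall g, phi (lam g) = 0) -> forall T, A T -> phi T = 0.
Proof.
move=> phi_lin phi_le phi_lam T AT; apply: (@normc_eq0_eps _ _ K) => e e0.
have [S sS TS] := Cstar_approx AT e0.
have phiS : phi S = 0.
  elim/span_ind: S / sS {TS} => [|c g S /Cstar_span AS IH].
    have := phi_lin 1 _ _ Cstar0 Cstar0.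
    by rewrite scale1r addr0 mul1r => /eqP; rewrite -subr_eq subrr => /eqP.
  by rewrite (phi_lin _ _ _ (Cstar_left_regular g) AS) phi_lam IH mulr0 addr0.
have -> : phi T = phi (T - S).
  by rewrite addrC -scaleN1r (phi_lin _ _ _ (Cstar_span sS) AT) phiS mulr0 add0r.
exact: phi_le (CstarB AT (Cstar_span sS)) TS.
Qed.

Lemma Cstar_right_translate T x f : A T ->
  T (right_translate x f) = right_translate x (T f).
Proof.
move=> AT; apply: ell2P => y; apply/eqP; rewrite -subr_eq0; apply/eqP.
move: T AT; apply: (@Cstar_functional_eq0 _ (2 * ell2_norm f)) => [c S T _ _|T M _ TM|g].
- by rewrite !right_translateE !opE !ell2E; ring.
- apply: le_trans (normc_leB _ _) _.
  apply: le_trans (lerD (normc_le_ell2_norm _ _) (normc_le_ell2_norm _ _)) _.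
  rewrite right_translate_norm.
  by have := TM (right_translate x f); have := TM f; rewrite right_translate_norm; lra.
- by rewrite right_translateE !left_regularE right_translateE mulgA subrr.
Qed.

Lemma Cstar_adjoint T : A T -> exists2 S, A S & adjoint T S.
Proof.
move=> AT; have half_gt0 n : 0 < 2^-1 ^+ n :> R by rewrite exprn_gt0 ?invr_gt0.
have /choice[V V_T] : forall n, exists V, span V /\ opnorm_le (T - V) (2^-1 ^+ n).
  by move=> n; have [V sV TV] := Cstar_approx AT (half_gt0 n); exists V.
have /choice[W W_V] : forall n, exists W, span W /\ adjoint (V n) W.
  by move=> n; have [W sW VW] := span_adjoint (V_T n).1; exists W.
have [|n|L lL L_W] := @op_complete _ _ W 2.
- by move=> n; exact: span_linear (W_V n).1.
- apply: adjoint_opnorm_le (adjointB (W_V n.+1).2 (W_V n).2) _.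
  have -> : V n.+1 - V n = (T - V n) - (T - V n.+1) by rewrite opprB [RHS]addrC subrKA.
  apply: opnorm_leW (opnorm_leB (V_T n).2 (V_T n.+1).2).
  by rewrite exprS; have := half_gt0 n; lra.
exists L.
  apply: (@Cstar_lim _ 4) => // e e0.
  have [n n_lt] := geometric_lt 1 (normr_half_lt1 R) e0.
  exists (W n); first exact: Cstar_span (W_V n).1.
  by apply: opnorm_leW (L_W n); lra.
apply: (@adjoint_lim _ _ _ _ 4) => e e0.
have [n n_lt] := geometric_lt 1 (normr_half_lt1 R) e0.
exists (W n), (V n); split; first exact: (W_V n).2.
- by apply: opnorm_leW (V_T n).2; have := half_gt0 n; lra.
- by apply: opnorm_leW (L_W n); lra.
Qed.

Lemma Cstar_delta1_separating T : A T -> T (delta R 1%g) = 0 -> T = 0.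
Proof.
move=> AT T1; have [S AS TS] := Cstar_adjoint AT.
have Tdelta x : T (delta R x) = 0.
  rewrite -[x]mul1g -[X in (_ * X)%g](invgK x) -right_translate_delta.
  by rewrite Cstar_right_translate // T1; exact: ell2P.
have Sdelta x : S (delta R x) = 0.
  by apply: ell2P => y; rewrite -dot_delta (adjoint_sym TS) Tdelta linear0r.
by apply/funext => f; apply: ell2P => x; rewrite -dot_delta TS Sdelta linear0r.
Qed.

Lemma Cstar_fixpoint (P : set op) (Phi : op -> op) (c : R) :
  P `<=` A -> P 0 -> (forall T, P T -> P (Phi T)) -> opnorm_le (Phi 0) c ->
  (forall L, A L -> (forall e, 0 < e -> exists2 T, P T & opnorm_le (L - T) e) -> P L) ->
  (forall S T M, P S -> P T -> opnorm_le (S - T) M ->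
     opnorm_le (Phi S - Phi T) (2^-1 * M)) ->
  exists2 L, P L & Phi L = L.
Proof.
move=> PA P0 PhiP Phi0 P_closed Phi_contract.
pose w n := iter n Phi 0.
have Pw n : P (w n) by elim: n => // n; exact: PhiP.
have w_le n : opnorm_le (w n.+1 - w n) (c * 2^-1 ^+ n).
  elim: n => [|n IH]; first by rewrite subr0 expr0 mulr1.
  by rewrite exprS mulrCA; exact: Phi_contract (Pw _) (Pw _) IH.
have [L lL L_w] := op_complete (fun n => Cstar_linear (PA _ (Pw n))) w_le.
have w_L e : 0 < e -> exists n, opnorm_le (L - w n) e /\ opnorm_le (L - w n.+1) e.
  move=> e0; have [n n_lt] := geometric_lt (2 * c) (normr_half_lt1 R) e0.
  have cn_ge0 : 0 <= c * 2^-1 ^+ n.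
    by rewrite mulr_ge0 ?(opnorm_le_ge0 Phi0) // exprn_ge0 ?invr_ge0.
  exists n; split; first exact: opnorm_leW (ltW n_lt) (L_w n).
  by apply: opnorm_leW (L_w n.+1); rewrite exprS; lra.
have AL : A L.
  apply: (@Cstar_lim _ 1) => // e /w_L[n [L_wn _]].
  by exists (w n); [exact: PA|rewrite mul1r].
have PL : P L by apply: P_closed => // e /w_L[n [L_wn _]]; exists (w n).
exists L => //; apply: (@op_eq_lim _ _ _ _ 2) => e e0; have [n [L_wn L_wSn]] := w_L e e0.
rewrite (_ : Phi L - L = (Phi L - Phi (w n)) - (L - w n.+1)).
  by apply: opnorm_leW (opnorm_leB (Phi_contract _ _ _ PL (Pw n) L_wn) L_wSn); lra.
by rewrite opprB addrA subrK.
Qed.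

(* 1 - w is a square root of 1 - x if and only if w is a fixed point of the map
   w |-> (x + w^2) / 2, which contracts the ball of radius 1/2. *)
Lemma Cstar_sqrt x : A x -> adjoint x x -> opnorm_le x 2^-1 ->
  exists y, [/\ A y, adjoint y y & y \o y = idfun - x].
Proof.
move=> Ax xx x_le; pose Phi w : op := 2^-1 *: (x + (w \o w)).
pose P : set op := [set w | [/\ A w, adjoint w w & opnorm_le w 2^-1]].
have normc_half : normc (2^-1 : C) = 2^-1.
  by rewrite normcV normc_natr.
have half_ge0 : 0 <= 2^-1 :> R by rewrite invr_ge0.
have PhiP w : P w -> P (Phi w).
  move=> [Aw ww w_le]; split.
  - exact: CstarZ (CstarD Ax (Cstar_comp Aw Aw)).
  - have := adjointZ 2^-1 (adjointD xx (adjoint_comp ww ww)).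
    by rewrite fmorphV rmorph_nat.
  - have := opnorm_leZ 2^-1 (opnorm_leD x_le (opnorm_le_comp w_le w_le)).
    by rewrite normc_half; apply: opnorm_leW; lra.
have P0 : P 0.
  split; [exact: Cstar0|exact: adjoint0|].
  exact: opnorm_leW half_ge0 (@opnorm_le0 _ _).
have P_closed L : A L -> (forall e, 0 < e -> exists2 w, P w & opnorm_le (L - w) e) -> P L.
  move=> AL L_lim; split=> //.
    apply: (@adjoint_lim _ _ _ _ 1) => e /L_lim[w [_ ww _] Lw].
    by exists w, w; rewrite mul1r.
  by apply: opnorm_le_lim => e /L_lim[w [_ _ w_le] Lw]; exists w.
have Phi_contract v w M : P v -> P w -> opnorm_le (v - w) M ->
    opnorm_le (Phi v - Phi w) (2^-1 * M).
  move=> [Av _ v_le] [_ _ w_le] /(opnorm_le_sqrB (Cstar_linear Av) v_le w_le).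
  move=> /(opnorm_leZ 2^-1); rewrite normc_half mulfV ?mul1r ?pnatr_eq0 //.
  by rewrite -scalerBr opprD addrACA subrr add0r.
have [_ _ Phi0_le] := PhiP 0 P0.
have [|L [AL LL _] PhiL] := Cstar_fixpoint _ P0 PhiP Phi0_le P_closed Phi_contract.
  by move=> w [].
exists (idfun - L); split; [exact: CstarB Cstar_id AL|exact: adjointB|].
have xE : x = 2 *: L - (L \o L).
  rewrite -[in 2 *: L]PhiL /Phi scalerA mulfV ?pnatr_eq0 // scale1r.
  by rewrite addrK.
apply/funext => f; rewrite xE /= !opE /= (zmod_morphism_linear (Cstar_linear AL)).
by apply: ell2P => g; rewrite !ell2E; ring.
Qed.

Section Ideal.
Variable I : set op.
Hypothesis idI : closed_ideal I.

Lemma idealZ c T : I T -> I (c *: T).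
Proof. by move=> IT; have := ideal_linear idI c IT (ideal0 idI); rewrite addr0. Qed.

Lemma idealD S T : I S -> I T -> I (S + T).
Proof. by move=> IS IT; have := ideal_linear idI 1 IS IT; rewrite scale1r. Qed.

(* The partial sums z (1 + y + ... + y^(n-1)) = 1 - y^n of the Neumann series of
   z = 1 - y lie in I and converge to 1. *)
Lemma ideal_near_id z : I z -> opnorm_le (idfun - z) 2^-1 -> I = A.
Proof.
move=> Iz; set y := idfun - z => y_le; have Az := ideal_sub idI Iz.
have Ay : A y := CstarB Cstar_id Az.
pose yn n : op := iter n (fun T => y \o T) idfun.
have Ayn n : A (yn n) by elim: n => [|n IH]; [exact: Cstar_id|exact: Cstar_comp Ay IH].
have yn_le n : opnorm_le (yn n) (2^-1 ^+ n).
  elim: n => [|n IH]; first by rewrite expr0; exact: opnorm_le_id.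
  by rewrite exprS; exact: opnorm_le_comp y_le IH.
have Iyn n : I (idfun - yn n).
  elim: n => [|n IH]; first by rewrite subrr; exact: ideal0.
  have -> : idfun - yn n.+1 = (idfun - yn n) + (z \o yn n).
    by apply/funext => f; rewrite /= /y !opE opprB addrCA addrC.
  exact: (idealD IH (ideal_mulr idI Iz (Ayn n))).
have Iid : I idfun.
  apply: (ideal_closed idI); split=> [|e e0]; first by case: Cstar_id.
  have [n n_lt] := geometric_lt 1 (normr_half_lt1 R) e0; rewrite mul1r in n_lt.
  exists (idfun - yn n); split=> // f; rewrite !opE opprB addrCA subrr addr0.
  exact: opnorm_leW (ltW n_lt) (yn_le n) f.
apply/seteqP; split=> [T|T AT]; first exact: (ideal_sub idI).
exact: (ideal_mull idI AT Iid).
Qed.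

End Ideal.

End ReducedCstar.

(** * Traces *)

Section Traces.
Variables (R : realType) (G : groupType).
Local Notation C := R[i].
Local Notation op := (ell2 R G -> ell2 R G).
Local Notation A := (@reduced_Cstar R G).
Local Notation lam := (@left_regular R G).
Implicit Types (f : ell2 R G) (g k : G) (S T x : op) (M : R).

Section TraceBound.
Variable tau : op -> C.
Hypothesis tr : normalized_trace tau.

Lemma trace0 : tau 0 = 0.
Proof.
have := trace_linear tr 1 (Cstar0 R G) (Cstar0 R G).
by rewrite scale1r addr0 mul1r => /eqP; rewrite -subr_eq subrr => /eqP.
Qed.

Lemma traceZ c T : A T -> tau (c *: T) = c * tau T.
Proof.
by move=> AT; have := trace_linear tr c AT (Cstar0 R G); rewrite !addr0 trace0 addr0.
Qed.

Lemma traceD S T : A S -> A T -> tau (S + T) = tau S + tau T.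
Proof. by move=> AS AT; have := trace_linear tr 1 AS AT; rewrite scale1r mul1r. Qed.

Lemma traceB S T : A S -> A T -> tau (S - T) = tau S - tau T.
Proof.
by move=> AS AT; rewrite addrC -scaleN1r (trace_linear tr) // mulN1r addrC.
Qed.

Lemma trace_sum (I : Type) (r : seq I) (F : I -> op) : (forall i, A (F i)) ->
  tau (\sum_(i <- r) F i) = \sum_(i <- r) tau (F i).
Proof.
move=> AF; elim: r => [|i r IH]; first by rewrite !big_nil trace0.
by rewrite !big_cons (traceD (AF i) (Cstar_sum r AF)) IH.
Qed.

Lemma trace_le1_selfadjoint x : A x -> adjoint x x -> opnorm_le x 2^-1 -> tau x <= 1.
Proof.
move=> Ax xx x_le; have [y [Ay yy y2]] := Cstar_sqrt Ax xx x_le.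
have := trace_pos tr Ay Ay yy; rewrite y2 (traceB (Cstar_id R G) Ax).
by rewrite (trace1 tr) subr_ge0.
Qed.

Lemma norm_trace_le1_selfadjoint x : A x -> adjoint x x -> opnorm_le x 2^-1 ->
  `|tau x| <= 1.
Proof.
move=> Ax xx x_le; have tx_le1 := trace_le1_selfadjoint Ax xx x_le.
have Nx_le1 : tau (- x) <= 1.
  rewrite -scaleN1r; apply: trace_le1_selfadjoint; first exact: CstarZ.
    by have := adjointZ (-1) xx; rewrite rmorphN1.
  by rewrite scaleN1r; exact: opnorm_leN.
rewrite real_ler_norml ?(ler1_real tx_le1) // tx_le1 andbT lerNl.
by rewrite -mulN1r -traceZ // scaleN1r.
Qed.

Lemma norm_trace_le1 T : A T -> opnorm_le T 4^-1 -> `|tau T| <= 1.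
Proof.
move=> AT T_le; have [S AS TS] := Cstar_adjoint AT.
have ST := adjoint_sym TS; have S_le := adjoint_opnorm_le TS T_le.
have quarterD : 4^-1 + 4^-1 = 2^-1 :> R by field.
have re_le : `|tau (T + S)| <= 1.
  apply: norm_trace_le1_selfadjoint; first exact: CstarD.
    by rewrite {2}[T + S]addrC; exact: adjointD.
  by rewrite -quarterD; exact: opnorm_leD.
have im_le : `|tau ('i *: (T - S))| <= 1.
  apply: norm_trace_le1_selfadjoint; first exact/CstarZ/CstarB.
    by have := adjointZ 'i (adjointB TS ST); rewrite conjCi scaleNr -scalerN opprB.
  by have := opnorm_leZ 'i (opnorm_leB T_le S_le); rewrite normc_i mul1r quarterD.
have -> : tau T = (tau (T + S) - 'i * tau ('i *: (T - S))) / 2.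
  rewrite (traceZ _ (CstarB AT AS)) (traceD AT AS) (traceB AT AS) mulrA -expr2 sqrCi.
  by field.
rewrite normrM normfV normr_nat ler_pdivrMr ?ltr0n // mul1r.
apply: le_trans (ler_normB _ _) _; rewrite normrM normCi mul1r.
exact: lerD.
Qed.

Lemma normc_trace_le T M : A T -> 0 < M -> opnorm_le T M -> normc (tau T) <= M * 4.
Proof.
move=> AT M0 T_le; pose c := (4 * M)^-1; have c0 : 0 < c by rewrite invr_gt0 mulr_gt0.
have : `|tau (c%:C *: T)| <= 1.
  apply: norm_trace_le1; first exact: CstarZ.
  have := opnorm_leZ c%:C T_le; rewrite normc_real gtr0_norm //.
  by rewrite /c invfM mulfVK // gt_eqF.
rewrite traceZ // -[X in X <= _]/((normc _)%:C) lecR normcM normc_real.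
by rewrite gtr0_norm // /c ler_pdivrMl ?mulr_gt0 // mulr1 mulrC.
Qed.

End TraceBound.

Section VectorTrace.
Variable xi : ell2 R G.
Hypothesis xi0 : xi != 0.

Definition vector_state T : C := ell2_dot (T xi) xi / ell2_dot xi xi.

Lemma vector_state_linear c S T :
  vector_state (c *: S + T) = c * vector_state S + vector_state T.
Proof. by rewrite /vector_state !opE linearPl mulrDl mulrA. Qed.

Lemma vector_state_le T M : opnorm_le T M -> normc (vector_state T) <= M.
Proof.
move=> TM; have xi_gt0 : 0 < ell2_norm xi ^+ 2.
  by rewrite -ltcR -dotff; exact: neq0_dnorm_gt0.
rewrite normcM normcV dotff normc_real.
rewrite gtr0_norm // ler_pdivrMr // expr2 mulrA.
by apply: le_trans (normc_dot_le _ _) _; rewrite ler_wpM2r ?ell2_norm_ge0.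
Qed.

Lemma vector_stateC_left_regular S : A S ->
  (forall g, vector_state (S \o lam g) = vector_state (lam g \o S)) ->
  forall T, A T -> vector_state (S \o T) = vector_state (T \o S).
Proof.
move=> AS S_lam T AT; apply/eqP; rewrite -subr_eq0; apply/eqP; move: T AT.
have [M SM] := Cstar_bounded AS.
apply: (@Cstar_functional_eq0 _ _ _ (2 * M)) => [c T T' _ _|T N _ TN|g].
- have -> : S \o (c *: T + T') = c *: (S \o T) + (S \o T').
    by apply/funext => f; rewrite /= (Cstar_linear AS).
  by rewrite !vector_state_linear; ring.
- apply: le_trans (normc_leB _ _) _.
  have := vector_state_le (opnorm_le_comp SM TN).
  have := vector_state_le (opnorm_le_comp TN SM).
  by lra.
- by rewrite S_lam subrr.
Qed.

Lemma vector_state_trace :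
  (forall g k, vector_state (lam (g * k)%g) = vector_state (lam (k * g)%g)) ->
  normalized_trace vector_state.
Proof.
have xi_gt0 : 0 < ell2_dot xi xi by exact: neq0_dnorm_gt0.
move=> lam_tr; split=> [c S T _ _|S T AT AS TS||S T AS AT].
- exact: vector_state_linear.
- by rewrite /vector_state /= (adjoint_sym TS) divr_ge0 ?dnorm_ge0.
- by rewrite /vector_state divff // gt_eqF.
- apply: vector_stateC_left_regular => // g; apply/esym.
  apply: vector_stateC_left_regular AS => [|k]; first exact: Cstar_left_regular.
  by rewrite -!left_regularM.
Qed.

End VectorTrace.

Definition canonical_trace : op -> C := vector_state (delta R 1%g).

Lemma canonical_traceE T : canonical_trace T = T (delta R 1%g) 1%g.
Proof. by rewrite /canonical_trace /vector_state !dot_delta deltaE eqxx divr1. Qed.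

Lemma delta_neq0 g : delta R g != 0.
Proof. by rewrite -(dnorm_eq0 (@ell2_dot R G)) /= dot_delta deltaE eqxx oner_eq0. Qed.

Lemma canonical_trace_left_regular g : canonical_trace (lam g) = (g == 1%g)%:R.
Proof. by rewrite canonical_traceE left_regular_delta mulg1 deltaE eq_sym. Qed.

Lemma canonical_trace_normalized : normalized_trace canonical_trace.
Proof.
apply: vector_state_trace => [|g k]; first exact: delta_neq0.
rewrite -!/canonical_trace !canonical_trace_left_regular; congr (nat_of_bool _)%:R.
by rewrite -(inj_eq (@mulIg _ k^-1%g)) mulgK mul1g -(inj_eq (@mulgI _ k)) mulgV.
Qed.

End Traces.

(** * Finite normal subgroups *)

Section NormalSubgroups.
Variables (G : groupType) (H : set G).
Hypothesis nH : normal_subgroup H.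
Implicit Types g h : G.

Lemma normal_subgroup_memV g : (g^-1%g \in H) = (g \in H).
Proof.
apply/idP/idP => /set_mem/(normal_subgroupV nH) gH; rewrite inE //.
by rewrite -(invgK g).
Qed.

Lemma normal_subgroup_memMr g h : H h -> ((g * h)%g \in H) = (g \in H).
Proof.
move=> Hh; apply/idP/idP => /set_mem gH; rewrite inE; last exact: normal_subgroupM.
by rewrite -(mulgK h g); apply: normal_subgroupM => //; exact: normal_subgroupV.
Qed.

Lemma normal_subgroup_memC g h : ((g * h)%g \in H) = ((h * g)%g \in H).
Proof.
apply/idP/idP => /set_mem/(normal_subgroupJ nH); rewrite inE.
  by move=> /(_ g); rewrite /conjg -mulgA mulKg.
by move=> /(_ h); rewrite /conjg -mulgA mulKg.
Qed.

Lemma normal_subgroup_mulg_bijl h : H h -> set_bij H H (fun x => h * x)%g.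
Proof.
move=> Hh; split=> [x|x y _ _|x Hx].
- exact: normal_subgroupM.
- exact: mulgI.
- exists (h^-1 * x)%g; last exact: mulVKg.
  by apply: normal_subgroupM => //; exact: normal_subgroupV.
Qed.

Lemma normal_subgroup_mulg_bijr h : H h -> set_bij H H (fun x => x * h)%g.
Proof.
move=> Hh; split=> [x Hx|x y _ _|x Hx].
- exact: normal_subgroupM.
- exact: mulIg.
- exists (x * h^-1)%g; last exact: mulgVK.
  by apply: normal_subgroupM => //; exact: normal_subgroupV.
Qed.

Lemma normal_subgroup_eq1P : (forall h, H h -> h = 1%g) -> H = [set 1%g].
Proof.
by move=> H1; apply/seteqP; split=> [h /H1|_ ->] //; exact: normal_subgroup1.
Qed.

Lemma finite_amenable (R : realType) : finite_set H -> amenable R H.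
Proof.
move=> finH; pose count (B : set G) := \sum_(x \in H) ((x \in B)%:R : R).
have count_ge0 B : 0 <= count B by apply: fsumr_ge0 => x _; rewrite ler0n.
have countH : 0 < count H.
  rewrite /count (fsbigD1 1%g) //; last exact: normal_subgroup1.
  rewrite mem_set; last exact: normal_subgroup1.
  by rewrite ltr_pwDl // fsumr_ge0.
exists (fun B => count B / count H); split=> [|B _|B B' _ _ BB'|h B Hh _].
- by rewrite divff // gt_eqF.
- by rewrite divr_ge0 // ltW.
- rewrite -mulrDl -fsbig_split //=; congr (_ / _); apply: eq_fsbigr => x _.
  rewrite -natrD in_setU; congr (_%:R); case: (boolP (x \in B)) => //= xB.
  case: (boolP (x \in B')) => // xB'.
  have : (B `&` B') x by split; exact: set_mem.
  by rewrite BB'.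
- congr (_ / _); rewrite /count (reindex_fsbig _ _ _ _ (normal_subgroup_mulg_bijl Hh)).
  apply: eq_fsbigr => x _; congr (nat_of_bool _)%:R; apply/idP/idP => /set_mem.
    by move=> [y By /mulgI <-]; exact: mem_set.
  by move=> Bx; apply: mem_set; exists x.
Qed.

End NormalSubgroups.

Lemma icc_finite_normal (G : groupType) (H : set G) :
  icc G -> normal_subgroup H -> finite_set H -> H = [set 1%g].
Proof.
move=> iccG nH finH; apply: normal_subgroup_eq1P => // h Hh; apply: contrapT => /eqP h1.
apply: (iccG h h1); apply: sub_finite_set finH.
by move=> _ [x _ <-]; exact: normal_subgroupJ.
Qed.

Section InvariantIdeal.
Variables (R : realType) (G : groupType) (H : set G).
Hypothesis nH : normal_subgroup H.
Local Notation op := (ell2 R G -> ell2 R G).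
Local Notation A := (@reduced_Cstar R G).
Local Notation lam := (@left_regular R G).
Implicit Types (f : ell2 R G) (g h : G) (S T : op).

Definition invariant_ideal : set op :=
  [set T | A T /\ forall h, H h -> T \o lam h = T].

Lemma invariant_ideal_mulr S T : invariant_ideal T -> A S -> invariant_ideal (T \o S).
Proof.
move=> [AT T_inv] AS; split=> [|h Hh]; first exact: Cstar_comp.
have [M TM] := Cstar_bounded AT; have lT := Cstar_linear AT.
apply/funext => f; apply: ell2P => y; apply/eqP; rewrite -subr_eq0; apply/eqP.
move: S AS; apply: (@Cstar_functional_eq0 _ _ _ (M * (2 * ell2_norm f)))
  => [c S S' _ _|S N _ SN|g].
- by rewrite /= !lT !ell2E; ring.
- have TS_le k : normc (T (S k) y) <= M * (N * ell2_norm k).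
    apply: le_trans (normc_le_ell2_norm _ _) (le_trans (TM _) _).
    by rewrite ler_wpM2l ?(opnorm_le_ge0 TM).
  apply: le_trans (normc_leB _ _) (le_trans (lerD (TS_le _) (TS_le _)) _).
  by rewrite left_regular_norm; lra.
- apply/eqP; rewrite subr_eq0; apply/eqP; congr (ell2_fun _ y).
  have Hgh : H (h ^ g^-1)%g by exact: normal_subgroupJ.
  rewrite /= left_regular_comp.
  have -> : (g * h = (h ^ g^-1) * g)%g by rewrite /conjg invgK mulgA mulgVK.
  rewrite -left_regular_comp.
  exact: (congr1 (fun V : op => V (lam g f)) (T_inv _ Hgh)).
Qed.

Lemma invariant_ideal_closed : closed_ideal invariant_ideal.
Proof.
split=> [T []||c S T [AS S_inv] [AT T_inv]|S T AS [AT T_inv]|S T|T [[lT _] T_lim]].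
- by [].
- by split; first exact: Cstar0.
- split=> [|h Hh]; first exact: Cstar_lin.
  by rewrite -{2}(S_inv h Hh) -{2}(T_inv h Hh).
- split=> [|h Hh]; first exact: Cstar_comp.
  by rewrite -compA T_inv.
- exact: invariant_ideal_mulr.
- split=> [|h Hh].
    apply: (@Cstar_lim _ _ _ 1) => // e /T_lim[S [[AS _] TS]].
    by exists S => // f; rewrite mul1r; exact: TS.
  apply: (@op_eq_lim _ _ _ _ 2) => e /T_lim[S [[AS S_inv] TS]].
  rewrite (_ : _ - T = ((T - S) \o lam h) - (T - S)).
    have {}TS : opnorm_le (T - S) e := TS.
    apply: opnorm_leW (opnorm_leB (opnorm_le_comp TS (opnorm_le_left_regular h)) TS).
    by lra.
  rewrite -{2}(S_inv h Hh); apply/funext => f; rewrite !opE /=.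
  by rewrite opprB addrA subrK.
Qed.

End InvariantIdeal.

Section FiniteNormalSubgroup.
Variables (R : realType) (G : groupType) (H : set G).
Hypotheses (nH : normal_subgroup H) (finH : finite_set H).
Local Notation op := (ell2 R G -> ell2 R G).
Local Notation lam := (@left_regular R G).
Implicit Types (f : ell2 R G) (g h : G).

Definition indicator : ell2 R G := \sum_(h \in H) delta R h.

Lemma indicatorE g : indicator g = (g \in H)%:R.
Proof.
rewrite /indicator fsbig_finite // ell2_sumE -fsbig_finite //.
have [gH|gH] := boolP (g \in H).
  rewrite (fsbigD1 g _ _ finH (set_mem gH)) deltaE eqxx fsbig1 /= ?addr0 //.
  by move=> h [_ /eqP hg]; rewrite deltaE eq_sym (negPf hg).
rewrite fsbig1 // => h Hh; rewrite deltaE; case: eqP gH => // ->.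
by rewrite mem_set.
Qed.

Definition subgroup_sum : op := \sum_(h \in H) lam h.

Lemma subgroup_sum_delta1 : subgroup_sum (delta R 1%g) = indicator.
Proof.
rewrite /subgroup_sum /indicator !fsbig_finite // op_sumE.
by apply: eq_bigr => h _; rewrite left_regular_delta mulg1.
Qed.

Lemma subgroup_sum_invariant : invariant_ideal H subgroup_sum.
Proof.
split=> [|k Hk].
  rewrite /subgroup_sum fsbig_finite //.
  by apply: Cstar_sum => h; exact: Cstar_left_regular.
rewrite {2}/subgroup_sum (reindex_fsbig _ _ _ _ (normal_subgroup_mulg_bijr nH Hk)).
rewrite /subgroup_sum !fsbig_finite //; apply/funext => f; rewrite /= !op_sumE.
by apply: eq_bigr => h _; rewrite left_regularM.
Qed.

Lemma simple_finite_normal : reduced_Cstar_simple R G -> H = [set 1%g].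
Proof.
move=> /(_ _ (invariant_ideal_closed R nH))[I0|IA].
  have := subgroup_sum_invariant; rewrite I0 => sum0.
  have : indicator 1%g = 0 by rewrite -subgroup_sum_delta1 sum0.
  by rewrite indicatorE (mem_set (normal_subgroup1 nH)) => /eqP; rewrite oner_eq0.
have [_ id_inv] : invariant_ideal H (idfun : op) by rewrite IA; exact: Cstar_id.
apply: normal_subgroup_eq1P => // h Hh; apply: contrapT => /eqP h1.
have := congr1 (fun T : op => T (delta R 1%g) 1%g) (id_inv h Hh).
rewrite /= left_regular_delta mulg1 !deltaE eqxx eq_sym (negPf h1).
by move=> /eqP; rewrite eq_sym oner_eq0.
Qed.

Lemma indicator_neq0 : indicator != 0.
Proof.
apply/eqP => ind0; have /eqP := indicatorE 1%g.
by rewrite ind0 (mem_set (normal_subgroup1 nH)) eq_sym oner_eq0.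
Qed.

Lemma vector_state_indicator g : vector_state indicator (lam g) = (g \in H)%:R.
Proof.
have ind0 : ell2_dot indicator indicator != 0.
  by rewrite (dnorm_eq0 (@ell2_dot R G)) indicator_neq0.
rewrite /vector_state; have [gH|gH] := boolP (g \in H).
  suff -> : lam g indicator = indicator by rewrite divff.
  apply: ell2P => x; rewrite left_regularE !indicatorE; congr (nat_of_bool _)%:R.
  rewrite normal_subgroup_memC // normal_subgroup_memMr //.
  by apply: set_mem; rewrite normal_subgroup_memV.
have disjoint x : lam g indicator x * (indicator x)^* = 0.
  rewrite left_regularE !indicatorE; have [/set_mem Hx|_] := boolP (x \in H).
    by rewrite normal_subgroup_memMr // normal_subgroup_memV // (negPf gH) mul0r.
  by rewrite rmorph0 mulr0.
by rewrite [X in X / _](csum_supp1 (x := 1%g)) ?disjoint ?mul0r.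
Qed.

Lemma vector_state_indicator_normalized : normalized_trace (vector_state indicator).
Proof.
apply: vector_state_trace => [|g k]; first exact: indicator_neq0.
by rewrite !vector_state_indicator normal_subgroup_memC.
Qed.

Lemma unique_trace_finite_normal : reduced_Cstar_unique_trace R G -> H = [set 1%g].
Proof.
move=> [tau [_ uniq_tau]]; apply: normal_subgroup_eq1P => // h Hh.
have lam_h := @Cstar_left_regular R G h.
have := uniq_tau _ (canonical_trace_normalized R G) _ lam_h.
rewrite -(uniq_tau _ vector_state_indicator_normalized _ lam_h).
rewrite canonical_trace_left_regular vector_state_indicator mem_set //.
by case: eqP => // _ /eqP; rewrite eq_sym oner_eq0.
Qed.

End FiniteNormalSubgroup.

(** * Powers groups *)

Section PowersGroups.
Variable G : groupType.
Implicit Types (H E F : set G) (f g h x : G).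

(* The sets E_j are the gamma_j D of the definition. *)
Lemma powers_disjoint_family F (N : nat) : powers_group G ->
  finite_set F -> ~ F 1%g -> (1 <= N)%N ->
  exists (E : 'I_N -> set G) (gamma : 'I_N -> G),
    (forall j k, j != k -> E j `&` E k = set0) /\
    (forall j f x, F f -> ~ E j x -> E j (f ^ (gamma j)^-1 * x)%g).
Proof.
move=> [_ powers] finF F1 N1.
have [C [D [gamma [CD _ FC disjD]]]] := powers F N finF F1 N1.
exists (fun j => translate (gamma j) D), gamma; split=> // j f x Ff xD.
have C_or_D y : C y \/ D y by have : (C `|` D) y by rewrite CD.
have Cx : C ((gamma j)^-1 * x)%g.
  case: (C_or_D ((gamma j)^-1 * x)%g) => // Dx; case: xD.
  by exists ((gamma j)^-1 * x)%g; rewrite ?mulVKg.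
exists (f * ((gamma j)^-1 * x))%g; last by rewrite /conjg invgK -!mulgA.
case: (C_or_D (f * ((gamma j)^-1 * x))%g) => // Cfx.
have : (translate f C `&` C) (f * ((gamma j)^-1 * x))%g.
  by split=> //; exists ((gamma j)^-1 * x)%g.
by rewrite FC.
Qed.

Lemma disjoint3_two_notin (T : Type) (E : 'I_3 -> set T) (x : T) :
  (forall j k, j != k -> E j `&` E k = set0) ->
  exists j k, [/\ j != k, ~ E j x & ~ E k x].
Proof.
move=> disjE; have notin2 j k : j != k -> E j x -> ~ E k x.
  by move=> jk Ejx Ekx; have : (E j `&` E k) x by []; rewrite disjE.
pose i0 : 'I_3 := ord0; pose i1 := lift i0 ord0; pose i2 := lift i0 (lift ord0 ord0).
have [E0|nE0] := pselect (E i0 x); first by exists i1, i2; split=> //; exact: notin2 E0.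
have [E1|nE1] := pselect (E i1 x); last by exists i0, i1.
by exists i0, i2; split=> //; exact: notin2 E1.
Qed.

Lemma powers_icc : powers_group G -> icc G.
Proof.
move=> powers g g1 fin_class.
have class1 : ~ conj_class g 1%g by move=> [x _ /eqP]; rewrite conjg_eq1; apply/negP.
have [E [gamma [disjE E_absorbs]]] :=
  powers_disjoint_family powers fin_class class1 (isT : 1 <= 3)%N.
have E_absorbs_g j x : ~ E j x -> E j (g * x)%g.
  have class_g : conj_class g (g ^ gamma j)%g by exists (gamma j).
  by move=> /(E_absorbs j _ x class_g); rewrite conjgK.
have [j [k [jk /E_absorbs_g Ej /E_absorbs_g Ek]]] := disjoint3_two_notin 1%g disjE.
by have : (E j `&` E k) (g * 1)%g by []; rewrite disjE.
Qed.

Section Mean.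
Variables (R : realType) (H : set G) (m : set G -> R).
Hypothesis nH : normal_subgroup H.
Hypothesis mean_total : m H = 1.
Hypothesis mean_ge0 : forall A, A `<=` H -> 0 <= m A.
Hypothesis meanD : forall A B, A `<=` H -> B `<=` H -> A `&` B = set0 ->
  m (A `|` B) = m A + m B.
Hypothesis mean_translate : forall h A, H h -> A `<=` H -> m (translate h A) = m A.

Lemma mean_le A B : A `<=` B -> B `<=` H -> m A <= m B.
Proof.
move=> AB BH; have DH : B `\` A `<=` H by move=> x [/BH].
rewrite -(setDUK AB) meanD ?lerDl ?mean_ge0 //; first exact: subset_trans BH.
exact: setDIK.
Qed.

Lemma mean_half_le h E : H h -> (forall x, ~ E x -> E (h * x)%g) -> 1 <= 2 * m (H `&` E).
Proof.
move=> Hh E_absorbs; have DH : H `\` E `<=` H by move=> x [].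
have IH : H `&` E `<=` H by move=> x [].
have : m (translate h (H `\` E)) <= m (H `&` E).
  apply: mean_le IH => _ [x [Hx Ex] <-]; split; last exact: E_absorbs.
  exact: normal_subgroupM.
rewrite mean_translate // => mDI; have := mean_total.
have -> : m H = m (H `&` E) + m (H `\` E).
  rewrite -meanD ?setUIDK //; apply/seteqP; split=> // x [[_ Ex] []] //.
by lra.
Qed.

Lemma mean_sum_disjoint_le (N : nat) (E : 'I_N -> set G) :
  (forall j k, j != k -> E j `&` E k = set0) -> \sum_j m (H `&` E j) <= 1.
Proof.
move=> disjE; have m0 : m set0 = 0.
  have := meanD (@sub0set _ H) (@sub0set _ H) (setI0 _).
  by rewrite setU0 => /eqP; rewrite -subr_eq subrr => /eqP.
have subH (B : set G) : H `&` B `<=` H by move=> x [].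
suff sumE (s : seq 'I_N) : uniq s ->
    \sum_(j <- s) m (H `&` E j) = m (H `&` \big[setU/set0]_(j <- s) E j).
  by rewrite sumE ?index_enum_uniq // -[leRHS]mean_total mean_le.
elim: s => [|j s IH] /=; first by rewrite !big_nil setI0.
move=> /andP[js us]; rewrite !big_cons IH // setIUr meanD // setIACA -bigcup_seq.
apply/seteqP; split=> // x [_ [Ejx [k /= ks Ekx]]].
have jk : j != k by apply: contraNneq js => ->.
by have : (E j `&` E k) x by []; rewrite disjE.
Qed.

End Mean.

Lemma powers_amenable_normal (R : realType) H :
  powers_group G -> normal_subgroup H -> amenable R H -> H = [set 1%g].
Proof.
move=> powers nH [m [m1 m_ge0 mD mT]].
apply: normal_subgroup_eq1P => // h Hh; apply: contrapT => h1.
have F1 : ~ [set h] 1%g by move=> /esym.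
have [E [gamma [disjE E_absorbs]]] :=
  powers_disjoint_family powers (finite_set1 h) F1 (isT : 1 <= 3)%N.
have half_le (j : 'I_3) : 1 <= 2 * m (H `&` E j).
  have Hhj : H (h ^ (gamma j)^-1)%g by exact: normal_subgroupJ.
  by apply: (mean_half_le nH m1 m_ge0 mD mT Hhj) => x; exact: E_absorbs.
have := mean_sum_disjoint_le m1 m_ge0 mD disjE; rewrite !big_ord_recl big_ord0.
have := half_le ord0; have := half_le (lift ord0 ord0).
by have := half_le (lift ord0 (lift ord0 ord0)); lra.
Qed.

End PowersGroups.

(** * Powers averaging *)

Section Averaging.
Variables (R : realType) (G : groupType).
Local Notation C := R[i].
Local Notation op := (ell2 R G -> ell2 R G).
Local Notation A := (@reduced_Cstar R G).
Local Notation lam := (@left_regular R G).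
Local Notation tau0 := (@canonical_trace R G).
Implicit Types (f u : ell2 R G) (g x : G) (S T : op) (E : set G) (M : R).

Definition average N (gamma : 'I_N -> G) T : op :=
  N%:R^-1 *: \sum_j (lam (gamma j) \o T \o lam (gamma j)^-1%g).

Lemma averageE N (gamma : 'I_N -> G) T f : average gamma T f =
  N%:R^-1 *: \sum_j lam (gamma j) (T (lam (gamma j)^-1%g f)).
Proof. by rewrite /average opZE op_sumE. Qed.

Lemma averageD N (gamma : 'I_N -> G) S T :
  average gamma (S + T) = average gamma S + average gamma T.
Proof.
apply/funext => f; rewrite opDE !averageE -scalerDr -big_split; congr (_ *: _).
by apply: eq_bigr => j _; rewrite opDE linearD.
Qed.

Lemma average_scalar N (gamma : 'I_N -> G) c : (0 < N)%N ->
  average gamma (c *: idfun) = c *: idfun.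
Proof.
move=> N0; apply/funext => f; rewrite averageE.
rewrite (eq_bigr (fun=> c *: f)) => [|j _].
  rewrite sumr_const card_ord -[X in _ *: X]scaler_nat (scalerA N%:R^-1).
  by rewrite mulVf ?scale1r // pnatr_eq0 -lt0n.
by rewrite opZE linearZ /= left_regular_comp mulgV left_regular1.
Qed.

Lemma Cstar_average N (gamma : 'I_N -> G) T : A T -> A (average gamma T).
Proof.
move=> AT; apply: CstarZ; apply: Cstar_sum => j.
exact: Cstar_comp (Cstar_comp (Cstar_left_regular R _) AT) (Cstar_left_regular R _).
Qed.

Lemma trace_average tau N (gamma : 'I_N -> G) T : normalized_trace tau ->
  (0 < N)%N -> A T -> tau (average gamma T) = tau T.
Proof.
move=> tr N0 AT; have AJ j : A (lam (gamma j) \o T \o lam (gamma j)^-1%g).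
  exact: Cstar_comp (Cstar_comp (Cstar_left_regular R _) AT) (Cstar_left_regular R _).
rewrite /average (traceZ tr _ (Cstar_sum _ AJ)) (trace_sum tr) //.
rewrite (eq_bigr (fun=> tau T)) => [|j _].
  by rewrite sumr_const card_ord -[X in _ * X]mulr_natl mulKf // pnatr_eq0 -lt0n.
rewrite -compA (traceC tr (Cstar_left_regular R _)); last first.
  exact: Cstar_comp AT (Cstar_left_regular R _).
by rewrite -compA -left_regularM mulVg left_regular1.
Qed.

Lemma opnorm_le_average N (gamma : 'I_N -> G) T M : (0 < N)%N -> opnorm_le T M ->
  opnorm_le (average gamma T) M.
Proof.
move=> N0 TM f; rewrite averageE ell2_normZ normcV normc_natr.
rewrite ler_pdivrMl ?ltr0n //; apply: le_trans (ell2_norm_sum _ _) _.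
apply: (@le_trans _ _ (\sum_(j < N) M * ell2_norm f)).
  apply: ler_sum => j _; rewrite left_regular_norm; apply: le_trans (TM _) _.
  by rewrite left_regular_norm.
by rewrite sumr_const card_ord [leRHS]mulr_natl.
Qed.

Lemma left_regular_corner g E f : (forall x, ~ E x -> E (g * x)%g) ->
  restr (~` E) (lam g (restr (~` E) f)) = 0.
Proof.
move=> E_absorbs; rewrite left_regular_restr restr_comp.
rewrite (_ : _ `&` _ = set0) ?restr0 //; apply/seteqP; split=> // x [Ex [y Ey gy]].
by apply: Ex; rewrite -gy; exact: E_absorbs.
Qed.

Lemma conj_span_corner (s : seq (C * G)) g E f :
  (forall p x, p \in s -> ~ E x -> E (p.2 ^ g^-1 * x)%g) ->
  restr (~` E) (lam g ((\sum_(p <- s) p.1 *: lam p.2) (lam g^-1%g (restr (~` E) f)))) = 0.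
Proof.
move=> E_absorbs; rewrite op_sumE !linear_sum big_seq big1 // => p ps.
rewrite opE !linearZ /= !left_regular_comp.
have -> : (g * p.2 * g^-1 = p.2 ^ g^-1)%g by rewrite /conjg invgK mulgA.
by rewrite left_regular_corner ?scaler0 // => x; exact: E_absorbs.
Qed.

(* By the corner condition, y_j u = P y_j u + (1 - P) y_j P u for the projection P to
   the functions supported in E_j. The orthogonality of these projections makes the sum
   of each of the two terms grow like sqrt N instead of N. *)
Lemma sum_corner_le N (E : 'I_N -> set G) (y : 'I_N -> op) M u :
  (forall j k, j != k -> E j `&` E k = set0) ->
  (forall j, linear (y j)) -> (forall j, opnorm_le (y j) M) -> 0 <= M ->
  (forall j f, restr (~` E j) (y j (restr (~` E j) f)) = 0) ->
  ell2_norm (\sum_j y j u) <= 2 * M * Num.sqrt N%:R * ell2_norm u.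
Proof.
move=> disjE ly yM M0 corner; pose b := M * Num.sqrt N%:R * ell2_norm u.
have b0 : 0 <= b by rewrite !mulr_ge0 ?sqrtr_ge0 ?ell2_norm_ge0.
have b2 : b ^+ 2 = N%:R * (M * ell2_norm u) ^+ 2.
  by rewrite /b !exprMn sqr_sqrtr ?ler0n //; ring.
have le_b f : ell2_norm f ^+ 2 <= b ^+ 2 -> ell2_norm f <= b.
  by rewrite ler_pXn2r ?nnegrE ?ell2_norm_ge0.
have -> : \sum_j y j u = \sum_j restr (E j) (y j u) +
    \sum_j restr (~` E j) (y j (restr (E j) u)).
  rewrite -big_split; apply: eq_bigr => j _ /=; rewrite -[LHS](restrC (E j)).
  congr (_ + _); rewrite -[in LHS](restrC (E j) u).
  have := ly j 1 (restr (E j) u) (restr (~` E j) u); rewrite !scale1r => ->.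
  by rewrite linearD /= corner addr0.
have -> : 2 * M * Num.sqrt N%:R * ell2_norm u = b + b by rewrite /b; ring.
apply: le_trans (ell2_normD _ _) _; apply: lerD; apply: le_b; rewrite b2.
  rewrite (sqr_norm_sum_restr disjE) mulr_natl -[N in _ *+ N]card_ord -sumr_const.
  apply: ler_sum => j _; rewrite ler_pXn2r ?nnegrE ?mulr_ge0 ?ell2_norm_ge0 //.
  exact: le_trans (restr_norm _ _) (yM j u).
apply: (@le_trans _ _ ((\sum_j M * ell2_norm (restr (E j) u)) ^+ 2)).
  rewrite ler_pXn2r ?nnegrE ?ell2_norm_ge0 ?sumr_ge0 // => [|j _]; last first.
    by rewrite mulr_ge0 ?ell2_norm_ge0.
  apply: le_trans (ell2_norm_sum _ _) _; apply: ler_sum => j _.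
  exact: le_trans (restr_norm _ _) (yM j _).
apply: le_trans (sqr_sum_le _) _; rewrite ler_wpM2l ?ler0n //.
under eq_bigr do rewrite exprMn.
by rewrite -mulr_sumr exprMn ler_wpM2l ?sqr_ge0 // sum_sqr_norm_restr.
Qed.

Lemma opnorm_le_average_corner N (gamma : 'I_N -> G) (E : 'I_N -> set G)
    (s : seq (C * G)) M : (0 < N)%N ->
  (forall j k, j != k -> E j `&` E k = set0) ->
  (forall j p x, p \in s -> ~ E j x -> E j (p.2 ^ (gamma j)^-1 * x)%g) ->
  opnorm_le (\sum_(p <- s) p.1 *: lam p.2) M ->
  opnorm_le (average gamma (\sum_(p <- s) p.1 *: lam p.2)) (2 * M / Num.sqrt N%:R).
Proof.
move=> N0 disjE E_absorbs; set x := \sum_(p <- s) _ => xM u.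
pose y j : op := lam (gamma j) \o x \o lam (gamma j)^-1%g.
have lx : linear x by apply: span_linear; exists s.
have ly j : linear (y j) by move=> c f h; rewrite /y /= linearP lx linearP.
have yM j : opnorm_le (y j) M.
  by move=> f; rewrite left_regular_norm (le_trans (xM _)) // left_regular_norm.
have y_corner j f : restr (~` E j) (y j (restr (~` E j) f)) = 0.
  by apply: conj_span_corner => p z; exact: E_absorbs.
rewrite averageE ell2_normZ normcV normc_natr ler_pdivrMl ?ltr0n //.
apply: le_trans (sum_corner_le u disjE ly yM (opnorm_le_ge0 xM) y_corner) _.
set r := Num.sqrt N%:R; have r0 : r != 0 by rewrite sqrtr_eq0 -ltNge ltr0n.
have -> : N%:R * (2 * M / r * ell2_norm u) = 2 * M * r * ell2_norm u.
  by rewrite -[N%:R]sqr_sqrtr ?ler0n // -/r; field.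
by [].
Qed.

Lemma powers_average_small (s : seq (C * G)) (e : R) : powers_group G ->
  (forall p, p \in s -> p.2 != 1%g) -> 0 < e ->
  exists N (gamma : 'I_N -> G), (0 < N)%N /\
    opnorm_le (average gamma (\sum_(p <- s) p.1 *: lam p.2)) e.
Proof.
move=> powers s1 e0.
have [M xM] : exists M, opnorm_le (\sum_(p <- s) p.1 *: lam p.2) M.
  by apply: span_bounded; exists s.
have M0 : 0 <= 2 * M / e by rewrite divr_ge0 ?mulr_ge0 ?(opnorm_le_ge0 xM) // ltW.
pose m := (Num.bound (2 * M / e)).+1.
have F1 : ~ [set` [seq p.2 | p <- s]] 1%g by move=> /mapP[p /s1 /eqP p1 /esym].
have [E [gamma [disjE E_absorbs]]] :=
  powers_disjoint_family powers (finite_seq _) F1 (isT : 0 < m ^ 2)%N.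
exists (m ^ 2)%N, gamma; split=> //.
apply: opnorm_leW (opnorm_le_average_corner _ disjE _ xM) => // [|j p z ps]; last first.
  by apply: E_absorbs; exact: map_f.
rewrite natrX sqrtr_sqr ger0_norm ?ler0n // ler_pdivrMr ?ltr0n //.
rewrite [leRHS]mulrC -ler_pdivrMr //.
by apply: le_trans (ltW (archi_boundP M0)) _; rewrite ler_nat.
Qed.

Lemma span_split_trace S : left_regular_span S -> exists2 s : seq (C * G),
  forall p, p \in s -> p.2 != 1%g &
  S = tau0 S *: idfun + \sum_(p <- s) p.1 *: lam p.2.
Proof.
elim/span_ind => [|c g U sU [s s1 SE]].
  by exists [::] => //; rewrite big_nil canonical_traceE scale0r addr0.
have trE : tau0 (c *: lam g + U) = c * (g == 1%g)%:R + tau0 U.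
  rewrite -canonical_trace_left_regular /canonical_trace.
  exact: vector_state_linear.
have [g1|g1] := eqVneq g 1%g.
  exists s => //; rewrite trE g1 eqxx mulr1 scalerDl -addrA -SE.
  by rewrite left_regular1.
exists ((c, g) :: s); first by move=> p; rewrite inE => /orP[/eqP -> //|]; exact: s1.
by rewrite trE (negPf g1) mulr0 add0r big_cons addrCA -SE.
Qed.

Lemma powers_averaging T (e : R) : powers_group G -> A T -> 0 < e ->
  exists N (gamma : 'I_N -> G), (0 < N)%N /\
    opnorm_le (average gamma T - tau0 T *: idfun) e.
Proof.
move=> powers AT e0; have e3 : 0 < e / 3 by rewrite divr_gt0.
have [S sS TS] := Cstar_approx AT e3; have AS := Cstar_span sS.
have [s s1 SE] := span_split_trace sS; set x := \sum_(p <- s) _ in SE.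
have [N [gamma [N0 x_le]]] := powers_average_small powers s1 e3.
exists N, gamma; split=> //.
have trB := traceB (canonical_trace_normalized R G) AT AS.
have avgS : average gamma S = tau0 S *: idfun + average gamma x.
  by rewrite [in LHS]SE (averageD gamma (tau0 S *: idfun)) average_scalar.
have -> : average gamma T - tau0 T *: idfun =
    average gamma (T - S) + average gamma x - tau0 (T - S) *: idfun.
  have -> : average gamma T = average gamma (T - S) + average gamma S.
    by rewrite -averageD subrK.
  rewrite avgS trB scalerBl opprB -!addrA; congr (_ + _).
  by rewrite addrCA.
have -> : e = e / 3 + e / 3 + e / 3 by field.
apply: opnorm_leB; first by apply: opnorm_leD => //; exact: opnorm_le_average.
apply: opnorm_leW (opnorm_leZ _ (@opnorm_le_id R G)); rewrite mulr1.
exact: (vector_state_le (delta_neq0 R 1%g) TS).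
Qed.

Lemma powers_unique_trace : powers_group G -> reduced_Cstar_unique_trace R G.
Proof.
move=> powers; exists tau0; split; first exact: canonical_trace_normalized.
move=> tau tr T AT; apply/eqP; rewrite -subr_eq0; apply/eqP.
apply: (@normc_eq0_eps _ _ 4) => e e0.
have [N [gamma [N0 avg_le]]] := powers_averaging powers AT e0.
have Aavg := Cstar_average gamma AT; have Ascalar := CstarZ (tau0 T) (Cstar_id R G).
have := normc_trace_le tr (CstarB Aavg Ascalar) e0 avg_le.
rewrite (traceB tr Aavg Ascalar) (trace_average gamma tr N0 AT).
by rewrite (traceZ tr _ (Cstar_id R G)) (trace1 tr) mulr1.
Qed.

Lemma ideal_average I N (gamma : 'I_N -> G) T :
  closed_ideal I -> I T -> I (average gamma T).
Proof.
move=> idI IT; apply: (idealZ idI); elim: (index_enum _) => [|j r IH].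
  by rewrite big_nil; exact: (ideal0 idI).
rewrite big_cons; apply: (idealD idI) IH.
apply: (ideal_mulr idI _ (Cstar_left_regular R _)).
exact: (ideal_mull idI (Cstar_left_regular R _) IT).
Qed.

Lemma powers_simple : powers_group G -> reduced_Cstar_simple R G.
Proof.
move=> powers I idI.
have [[T IT T0]|no_T] := pselect (exists2 T, I T & T <> 0); last first.
  left; apply/seteqP; split=> [T IT|_ ->]; last exact: ideal0.
  by apply: contrapT => T0; apply: no_T; exists T.
right; have AT := ideal_sub idI IT.
have [g Tg] : exists g, T (delta R 1%g) g != 0.
  apply: contrapT => T1; apply/T0/(Cstar_delta1_separating AT)/ell2P => g.
  by apply/eqP; apply: contra_notT T1 => Tg; exists g.
pose T' : op := (T (delta R 1%g) g)^-1 *: (lam g^-1%g \o T).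
have IT' : I T' by apply/(idealZ idI)/(ideal_mull idI (Cstar_left_regular R _) IT).
have tr1 : tau0 T' = 1.
  by rewrite canonical_traceE /T' opE ell2ZE left_regularE invgK mulg1 mulVf.
have half0 : 0 < 2^-1 :> R by rewrite invr_gt0.
have [N [gamma [N0]]] := powers_averaging powers (ideal_sub idI IT') half0.
rewrite tr1 scale1r => /opnorm_leN; rewrite opprB => avg_le.
exact: (ideal_near_id idI (ideal_average gamma idI IT') avg_le).
Qed.

End Averaging.

(** * Convergence actions *)

Section Dynamics.
Variables (R : realType) (G : groupType) (X : metricType R) (rho : G -> X -> X).
Hypothesis conv : convergence_action rho.
Implicit Types (f g : G) (x y r a : X) (U W K : set X) (u : nat -> G).

Lemma act_continuous g : continuous (rho g).
Proof. by have [+ _] := conv_homeo conv => /(_ g) [rho' []]. Qed.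

Lemma act_inj g : injective (rho g).
Proof. by have [+ _] := conv_homeo conv => /(_ g) [rho' [/can_inj]]. Qed.

Lemma actM f g x : rho (f * g)%g x = rho f (rho g x).
Proof. by have [_ ->] := conv_homeo conv. Qed.

Lemma act1 x : rho 1%g x = x.
Proof. by apply: (@act_inj 1%g); rewrite -actM mulg1. Qed.

Lemma actK g : cancel (rho g) (rho g^-1%g).
Proof. by move=> x; rewrite -actM mulVg act1. Qed.

Lemma actKV g : cancel (rho g^-1%g) (rho g).
Proof. by move=> x; rewrite -actM mulgV act1. Qed.

Lemma metric_separated x y : x != y ->
  exists U V, [/\ open U, open V, U x, V y & U `&` V = set0].
Proof.
have := @metric_hausdorff R X; rewrite open_hausdorff => /[apply].
move=> [[U V] /= [/set_mem Ux /set_mem Vy] [oU oV /eqP UV]].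
by exists U, V.
Qed.

Lemma conv_attract u r a K W : convergence_seq rho u r a ->
  compact K -> ~ K r -> nbhs a W -> \forall n \near \oo, forall x, K x -> W (rho (u n) x).
Proof.
move=> [_ /fam_cvgP cvg_a _] cK Kr /nbhs_ballP[e /= e0 eW].
have K_r : compactly_in (~` [set r]) K by split=> // x Kx xr; apply: Kr; rewrite -xr.
have nbhs_a : nbhs ((fun=> a) : {uniform` K -> X})
    [set h | forall y, K y -> ball a e (h y)].
  apply/uniform_nbhs; exists [set p | ball p.1 e p.2]; split; last by [].
  exact: entourage_ball (PosNum e0).
have near_ball : \forall n \near \oo, forall y, K y -> ball a e (rho (u n) y) :=
  cvg_a K K_r _ nbhs_a.
by apply: filterS near_ball => n u_ball x Kx; apply/eW/u_ball.
Qed.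

Lemma conv_pointwise u r a x : convergence_seq rho u r a -> x <> r ->
  rho (u n) x @[n --> \oo] --> a.
Proof.
move=> cs xr W /(conv_attract cs (@compact_set1 _ x) (fun e => xr (esym e))).
by apply: filterS => n; exact.
Qed.

Lemma conv_near_fixed u r a x : convergence_seq rho u r a ->
  (\forall n \near \oo, rho (u n) x = x) -> x = r \/ x = a.
Proof.
move=> cs x_fixed; have [->|/eqP xr] := eqVneq x r; first by left.
right; apply/esym/(cvg_unique _ (conv_pointwise cs xr)); first exact: metric_hausdorff.
exact: cvg_near_cst.
Qed.

Lemma almost_fixed_pair (S : set G) : infinite_set S -> exists r a,
  forall x, finite_set [set g | S g /\ rho g x <> x] -> x = r \/ x = a.
Proof.
move=> /infinite_injective_seq[v v_inj Sv].
have [phi [r [a [phi_incr cs]]]] := conv_subseq conv v_inj.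
exists r, a => x fin_moves; apply: (conv_near_fixed cs).
have v_phi_inj : injective (v \o phi) by case: cs.
apply: filterS (near_notin_finite v_phi_inj fin_moves) => n not_moved.
by apply: contrapT => moved; apply: not_moved; split=> //; exact: Sv.
Qed.

Lemma kernel_finite : finite_set [set g | rho g = id].
Proof.
apply: contrapT => /almost_fixed_pair[r [a fixed]].
have ra x : x = r \/ x = a.
  apply: fixed; rewrite (_ : [set _ | _] = set0); first exact: finite_set0.
  by apply/seteqP; split=> // g [/= ->].
have [x [y [z [xy yz xz]]]] := conv_three_points conv.
by case: (ra x) (ra y) (ra z) xy yz xz => -> [] -> [] ->; rewrite eqxx.
Qed.

Lemma kernel_normal : normal_subgroup [set g | rho g = id].
Proof.
split=> [|f g|g|g h] /=.
- by apply/funext => x; exact: act1.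
- by move=> f1 g1; apply/funext => x; rewrite actM f1 g1.
- by move=> g1; apply/funext => x; rewrite -{2}(actK g x) g1.
- by move=> g1; apply/funext => x; rewrite /conjg !actM g1 actK.
Qed.

Lemma no_finite_normal_effective :
  (forall H : set G, normal_subgroup H -> finite_set H -> H = [set 1%g]) -> effective rho.
Proof.
move=> /(_ _ kernel_normal kernel_finite) kernel1 f g fg; apply: divg1_eq.
suff : [set g | rho g = id] (f / g)%g by rewrite kernel1.
by apply/funext => x; rewrite actM fg actKV.
Qed.

Hypothesis minimal_rho : minimal_action rho.
Hypothesis non_elementary_rho : non_elementary rho.

Lemma space_infinite : infinite_set [set: X].
Proof. exact: sub_infinite_set non_elementary_rho. Qed.

Lemma exists_convergence_seq : exists u r a, convergence_seq rho u r a.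
Proof.
have [_ [u [r [a [cs _]]]]] := infinite_setN0 non_elementary_rho.
by exists u, r, a.
Qed.

Lemma minimal_transport x U : open U -> U !=set0 -> exists g, U (rho g x).
Proof.
move=> oU U0; have [y [Uy [g _ gx]]] := minimal_rho x U0 oU.
by exists g; rewrite gx.
Qed.

Lemma orbit_infinite x : infinite_set [set rho g x | g in [set: G]].
Proof.
move=> fin_orbit; apply: space_infinite; apply: sub_finite_set (fin_orbit) => y _.
apply: contrapT => y_notin.
have closed_orbit : closed [set rho g x | g in [set: G]].
  have acc := hausdorff_accessible (@metric_hausdorff R X).
  exact: (iffLR accessible_finite_set_closed acc _ fin_orbit).
have [g gx] := minimal_transport x (closed_openC closed_orbit) (ex_intro _ y y_notin).
by apply: gx; exists g.
Qed.

(* A convergence sequence precomposed so that its repelling point lies in U pushes the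
   complement of U into arbitrarily small neighbourhoods of its attracting point. *)
Lemma contracting_sequence U : open U -> U !=set0 ->
  exists (v : nat -> G) a, forall W, nbhs a W ->
    \forall n \near \oo, forall x, ~ U x -> W (rho (v n) x).
Proof.
move=> oU U0; have [u [r [a cs]]] := exists_convergence_seq.
have [t Ut] := minimal_transport r oU U0.
exists (fun n => u n * t^-1)%g, a => W aW.
have compact_tU : compact (rho t^-1%g @` (~` U)).
  apply: continuous_compact; first exact/continuous_subspaceT/act_continuous.
  apply: (subclosed_compact _ (conv_compact conv)) => //.
  exact: open_closedC.
have r_notin : ~ (rho t^-1%g @` (~` U)) r.
  by move=> [x Ux xr]; apply: Ux; rewrite -(actKV t x) xr.
apply: filterS (conv_attract cs compact_tU r_notin aW) => n u_W x Ux.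
by rewrite actM; apply: u_W; exists x.
Qed.

Lemma pingpong U N : open U -> U !=set0 ->
  exists gamma : 'I_N -> G, forall j k x y, j != k -> ~ U x -> ~ U y ->
    rho (gamma j) x <> rho (gamma k) y.
Proof.
move=> oU U0; have [v [a v_contracts]] := contracting_sequence oU U0.
have [p p_inj p_orbit] := infinite_injective_seq (@orbit_infinite a).
have /choice[g ga] : forall j, exists g, rho g a = p j.
  by move=> j; have [g _ ga] := p_orbit j; exists g.
have : \forall n \near \oo, forall jk : 'I_N * 'I_N, jk.1 != jk.2 ->
    forall x y, ~ U x -> ~ U y -> rho (g jk.1 * v n)%g x <> rho (g jk.2 * v n)%g y.
  apply: filter_forall => -[j k] /=.
  have [->|jk] := eqVneq j k; first exact: nearW.
  have : rho (g j) a != rho (g k) a.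
    by rewrite !ga; apply: contra jk => /eqP/p_inj/val_inj ->.
  move=> /metric_separated[A [B [oA oB Aa Ba AB]]].
  have near_a : nbhs a (rho (g j) @^-1` A `&` rho (g k) @^-1` B).
    by apply: filterI; apply: act_continuous; exact: open_nbhs_nbhs.
  apply: filterS (v_contracts _ near_a) => n v_AB _ x y /v_AB[Ax _] /v_AB[_ By] xy.
  have : (A `&` B) (rho (g k * v n)%g y) by split; [rewrite -xy actM|rewrite actM].
  by rewrite AB.
move=> /filter_ex[n disj]; exists (fun j : 'I_N => g j * v n)%g => j k x y jk.
exact: disj (j, k) jk x y.
Qed.

(* If f is trivial on U, its conjugates by a sequence contracting the complement of U are
   nontrivial but eventually fix every point except one. *)
Lemma effective_moves f U : effective rho -> f != 1%g -> open U -> U !=set0 ->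
  exists2 x, U x & rho f x <> x.
Proof.
move=> eff f1 oU U0; apply: contrapT => noU.
have fixU x : U x -> rho f x = x.
  by move=> Ux; apply: contrapT => fx; apply: noU; exists x.
have [v [a v_contracts]] := contracting_sequence oU U0.
pose w n := (f ^ (v n)^-1)%g.
have w_fixes x : x <> a -> \forall n \near \oo, rho (w n) x = x.
  move=> /eqP/metric_separated[A [W [_ oW Ax Wa AW]]].
  apply: filterS (v_contracts W (open_nbhs_nbhs (conj oW Wa))) => n v_W.
  rewrite /w /conjg invgK !actM fixU ?actKV //.
  apply: contrapT => /v_W; rewrite actKV => Wx.
  by have : (A `&` W) x by []; rewrite AW.
have w_moves n : exists2 x, x <> a & rho (w n) x <> x.
  apply: contrapT => no_moved; move: f1; apply/negP.
  rewrite negbK -(conjg_eq1 f (v n)^-1%g).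
  have fixed x : x <> a -> rho (w n) x = x.
    by move=> xa; apply: contrapT => wx; apply: no_moved; exists x.
  apply/eqP/eff/funext => x; rewrite act1; have [->|/eqP/fixed //] := eqVneq x a.
  by apply: contrapT => wa; apply: (wa); apply: (@act_inj (w n)); exact: fixed.
have : infinite_set (range w).
  apply: infinite_range => n; have [x xa wx] := w_moves n.
  by apply: filterS (w_fixes x xa) => m wmx wmn; apply: wx; rewrite -wmn.
move=> /almost_fixed_pair[r [b fixed]]; apply: space_infinite.
apply: (@sub_finite_set _ _ [set a; r; b]); last first.
  by rewrite !finite_setU; do !split; exact: finite_set1.
move=> x _; have [->|/eqP xa] := eqVneq x a; first by left; left.
have [M _ w_fixes_x] := w_fixes x xa.
have [|->|->] := fixed x; [|by left; right|by right].
apply: (@sub_finite_set _ _ (w @` `I_M)); last exact/finite_image/finite_II.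
move=> _ [[n _ <-] wx]; exists n => //=; rewrite ltnNge; apply/negP => Mn.
exact/wx/w_fixes_x.
Qed.

Lemma effective_wandering (s : seq G) : effective rho ->
  (forall f, f \in s -> f != 1%g) -> exists U,
    [/\ open U, U !=set0 & forall f, f \in s -> forall x, U x -> ~ U (rho f x)].
Proof.
move=> eff; elim: s => [|f s IH] s1.
  exists [set: X]; split=> //; first exact: openT.
  by have [x _] := conv_three_points conv; exists x.
have [|U [oU U0 s_wanders]] := IH; first by move=> g gs; apply: s1; rewrite inE gs orbT.
have [x Ux fx] := effective_moves eff (s1 f (mem_head f s)) oU U0.
have /metric_separated[A [B [oA oB Ax Bfx AB]]] : x != rho f x by apply/eqP => /esym.
exists (U `&` A `&` rho f @^-1` B); split.
- by apply: openI; [exact: openI|apply: open_comp => // y _; exact: act_continuous].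
- by exists x.
move=> g; rewrite inE => /orP[/eqP ->|gs] y [[Uy Ay] By] [[Ugy Agy] _].
  by have : (A `&` B) (rho f y) by []; rewrite AB.
exact: s_wanders gs y Uy Ugy.
Qed.

Lemma effective_powers : effective rho -> powers_group G.
Proof.
move=> eff; split=> [|F N /finite_seqP[s ->] F1 _].
  have [u [_ [_ [u_inj _ _]]]] := exists_convergence_seq.
  have [u0|u0] := eqVneq (u 0%N) 1%g; last by exists (u 0%N).
  by exists (u 1%N); rewrite -u0; apply/eqP => /u_inj.
have s1 f : f \in s -> f != 1%g by move=> fs; apply/eqP => f1; apply: F1; rewrite /= -f1.
have [U [oU U0 s_wanders]] := effective_wandering eff s1.
have [gamma gamma_disj] := pingpong N oU U0; have [x0 _] := U0.
exists [set g | U (rho g x0)], (~` [set g | U (rho g x0)]), gamma; split.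
- exact: setUv.
- exact: setICr.
- move=> f fs; apply/seteqP; split=> // _ [[g Ug <-]] /=.
  by rewrite actM; exact: s_wanders.
- move=> j k jk; apply/seteqP; split=> // _ [[g Ug <-] [h Uh hg]].
  by apply: (gamma_disj j k _ _ jk Ug Uh); rewrite -!actM hg.
Qed.

End Dynamics.

Theorem corollary1p2 (R : realType) (G : groupType) (X : metricType R)
    (rho : G -> X -> X) (countable_G : countable [set: G])
    (conv_rho : convergence_action rho) (min_rho : minimal_action rho)
    (nonelem_rho : non_elementary rho) :
  [<-> (* (i) *) effective rho;
       (* (ii) *) powers_group G;
       (* (iii) *) reduced_Cstar_simple R G;
       (* (iv) *) reduced_Cstar_unique_trace R G;
       (* (v) *) icc G;
       (* (vi) *) forall H : set G,
                    normal_subgroup H -> amenable R H -> H = [set 1%g];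
       (* (vii) *) forall H : set G,
                    normal_subgroup H -> finite_set H -> H = [set 1%g];
       (* (viii) *) forall (Y : metricType R) (sigma : G -> Y -> Y),
                    convergence_action sigma -> minimal_action sigma ->
                    non_elementary sigma -> effective sigma].
Proof.
have no_finite_powers :
    (forall H : set G, normal_subgroup H -> finite_set H -> H = [set 1%g]) ->
    powers_group G.
  by move=> /(no_finite_normal_effective conv_rho); exact: effective_powers.
tfae.
- exact: effective_powers.
- exact: powers_simple.
- move=> simple; apply: powers_unique_trace; apply: no_finite_powers => H nH finH.
  exact: simple_finite_normal simple.
- move=> unique_trace; apply: powers_icc; apply: no_finite_powers => H nH finH.
  exact: unique_trace_finite_normal unique_trace.
- move=> iccG H; apply: powers_amenable_normal; apply: no_finite_powers => K.
  exact: icc_finite_normal.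
- by move=> no_amenable H nH finH; apply: no_amenable => //; exact: finite_amenable.
- by move=> no_finite Y sigma conv_sigma _ _; exact: no_finite_normal_effective.
- exact.
Qed.
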